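(* Let $n$ be a positive odd integer. With the notation of the context, for constants $a_0,\dots,a_3,b_0,b_1,b_2,c\in\mathbb{C}$ (such that $f_1-f_2$ is not a zero divisor in $\mathcal{F}\otimes\mathcal{F}$, so that $\lambda_{od}$ is defined), the formula $$\{\phi,\psi\}=\Bigl(n\lambda_{od}+g_2-g_1+\tfrac12b_2(f_1-f_2)\Bigr)(\phi_1\psi_2-\psi_1\phi_2)+\phi_1D(\psi_2)+\phi_2D(\psi_1)-\psi_1D(\phi_2)-\psi_2D(\phi_1),\qquad \phi,\psi\in\mathcal{F}_n,$$ has values $\{\phi,\psi\}\in S^2\mathcal{F}_n$ and defines a quadratic Poisson bracket on the polynomial ring $S^*\mathcal{F}_n=\mathbb{C}[x_0,x_2,x_3,\dots,x_n]$. This Poisson bracket is linear (non-homogeneous) with respect to $c$ and the coefficients $a_0,\dots,a_3,b_0,b_1,b_2$ and therefore can be written in the form $$\{\cdot,\cdot\}=\{\cdot,\cdot\}_0+\sum_{i=0}^3a_i\{\cdot,\cdot\}_{i,1}+\sum_{j=0}^2b_j\{\cdot,\cdot\}_{j,2}+c\{\cdot,\cdot\}_3,$$ where the nine brackets $\{\cdot,\cdot\}_0$, $\{\cdot,\cdot\}_{i,1}$ ($0\le i\le3$), $\{\cdot,\cdot\}_{j,2}$ ($0\le j\le2$), $\{\cdot,\cdot\}_3$ on $\mathbb{C}[x_0,x_2,x_3,\dots,x_n]$ do not depend on $a_0,\dots,a_3,b_0,b_1,b_2,c$ and are pairwise compatible quadratic Poisson brackets.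
   Context: Let $P_{od}(t)=a_0+a_1t+a_2t^2+a_3t^3$ and $Q(t)=b_0+b_1t+b_2t^2$. Let $\mathcal{F}=\mathcal{F}_{od}$ be the commutative associative unital $\mathbb{C}$-algebra generated by $f,g$ with the single relation $(f+c)g^2=P_{od}(f)+Q(f)g$. Let $D$ be the derivation of $\mathcal{F}$ with $D(f)=2(f+c)g-Q(f)$, $D(g)=P_{od}'(f)+Q'(f)g-g^2$. For $h\in\mathcal{F}$ write $h_1=h\otimes1$, $h_2=1\otimes h$ in $\mathcal{F}\otimes\mathcal{F}$ (tensor product over $\mathbb{C}$), and $D(h_1)=D(h)\otimes 1$, $D(h_2)=1\otimes D(h)$. Let $\mathrm{Frac}(\mathcal{F}\otimes\mathcal{F})$ be the total ring of fractions (the field of fractions when $\mathcal{F}\otimes\mathcal{F}$ is a domain). The element $\lambda_{od}\in\mathrm{Frac}(\mathcal{F}\otimes\mathcal{F})$ is defined by $$(f_1-f_2)\lambda_{od}=(f_1+c)g_1+(f_2+c)g_2-\tfrac12Q(f_1)-\tfrac12Q(f_2).$$ Put $x_{2i}=f^i$, $x_{2i+3}=f^ig$ for $i=0,1,2,\dots$ (so $x_0,x_2,x_3,x_4,\dots$ are defined and there is no $x_1$). $\mathcal{F}_n\subset\mathcal{F}$ is the $n$-dimensional linear subspace with basis $\{x_0\}\cup\{x_i: 2\le i\le n\}$. The symmetric algebra $S^*\mathcal{F}_n$ is identified with the polynomial algebra $\mathbb{C}[x_0,x_2,x_3,\dots,x_n]$. The space $S^2\mathcal{F}_n$ is identified with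 the symmetric tensors in $\mathcal{F}_n\otimes\mathcal{F}_n\subset\mathcal{F}\otimes\mathcal{F}$ so that the product $\phi\psi$ corresponds to $\phi_1\psi_2+\psi_1\phi_2$. In particular $f_1^if_2^j+f_1^jf_2^i=x_{2i}x_{2j}$, $f_1^if_2^jg_2+f_1^jf_2^ig_1=x_{2i}x_{2j+3}$, $(f_1^if_2^j+f_1^jf_2^i)g_1g_2=x_{2i+3}x_{2j+3}$. The bracket given on $\mathcal{F}_n$ is extended to $S^*\mathcal{F}_n$ by bilinearity and the Leibniz rule. A Poisson bracket on a polynomial ring is quadratic if the bracket of any two generators is a homogeneous quadratic polynomial (possibly zero). Two Poisson brackets $\{\cdot,\cdot\}$ and $\{\cdot,\cdot\}'$ are compatible if $\{\cdot,\cdot\}+u\{\cdot,\cdot\}'$ is a Poisson bracket for every constant $u\in\mathbb{C}$. *)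

(* Defs.v *)
From HB Require Import structures.
From mathcomp Require Import all_boot all_order all_algebra ring_quotient.
From mathcomp Require Import boolp reals complex mpoly ring.

Set Implicit Arguments.
Unset Strict Implicit.
Unset Printing Implicit Defensive.

Import Order.TTheory GRing.Theory Num.Theory.

Local Open Scope ring_scope.
Local Open Scope quotient_scope.

Section GenIdeal.
Variable A : comNzRingType.

Definition gen_ideal (rs : seq A) : {pred A} :=
  fun p => `[< exists q : 'I_(size rs) -> A, p = \sum_i q i * rs`_i >].

Lemma gen_idealP (rs : seq A) p :
  reflect (exists q : 'I_(size rs) -> A, p = \sum_i q i * rs`_i)
          (p \in gen_ideal rs).
Proof. exact: asboolP. Qed.

Lemma gen_ideal_closed (B : nzRingType) (e : {rmorphism A -> B}) (rs : seq A) :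
  (forall r, r \in rs -> e r = 0) -> idealr_closed (gen_ideal rs).
Proof.
move=> ers; split.
- apply/gen_idealP; exists (fun=> 0).
  by rewrite big1 // => i _; rewrite mul0r.
- apply/gen_idealP => -[q /(congr1 e)/eqP].
  rewrite rmorph1 rmorph_sum big1 ?oner_eq0 // => i _.
  by rewrite rmorphM /= (ers rs`_i) ?mulr0 // mem_nth.
- move=> a u v /gen_idealP[p ->] /gen_idealP[q ->].
  apply/gen_idealP; exists (fun i => a * p i + q i).
  rewrite mulr_sumr -big_split /=; apply: eq_bigr => i _.
  by rewrite mulrDl mulrA.
Qed.
End GenIdeal.

Module QuotientAlgebra.
Section QuotientAlgebra.
Variables (K : comNzRingType) (A : comAlgType K) (I : idealr A).
Local Notation Q := {ideal_quot I}.

Definition scale (a : K) : Q -> Q := lift_op1 Q ( *:%R a).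

Lemma pi_scale a : {morph \pi_Q : x / a *: x >-> scale a x}.
Proof.
move=> x; unlock scale; apply/eqP; rewrite -Quotient.idealrBE.
rewrite -scalerBr -mulr_algl; apply: idealMr.
by rewrite Quotient.idealrBE reprK.
Qed.

Fact scaleA a b v : scale a (scale b v) = scale (a * b) v.
Proof. by rewrite -[v]reprK -!pi_scale scalerA. Qed.
Fact scale1 : left_id 1 scale.
Proof. by move=> v; rewrite -[v]reprK -!pi_scale scale1r. Qed.
Fact scaleDr : right_distributive scale +%R.
Proof.
by move=> a u v; rewrite -[u]reprK -[v]reprK -rmorphD -!pi_scale -rmorphD scalerDr.
Qed.
Fact scaleDl v : {morph scale^~ v : a b / a + b}.
Proof. by move=> a b; rewrite -[v]reprK -!pi_scale -rmorphD scalerDl. Qed.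

HB.instance Definition _ :=
  GRing.Zmodule_isLmodule.Build K Q scaleA scale1 scaleDr scaleDl.

Fact scaleAl a (u v : Q) : a *: (u * v) = (a *: u) * v.
Proof.
have E b (w : Q) : b *: w = scale b w by [].
by rewrite !E -[u]reprK -[v]reprK -rmorphM -!pi_scale -rmorphM scalerAl.
Qed.

HB.instance Definition _ := GRing.Lmodule_isLalgebra.Build K Q scaleAl.
HB.instance Definition _ := GRing.Lalgebra_isComAlgebra.Build K Q.

HB.instance Definition _ :=
  GRing.isScalable.Build K A Q *:%R (\pi_Q) (fun a x => pi_scale a x).
End QuotientAlgebra.
End QuotientAlgebra.
HB.export QuotientAlgebra.


(* Total ring of fractions: fractions x / s with s a regular element of A,
   i.e. not a zero divisor, modulo x / s = y / t <-> x * t = y * s. *)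
Module TotalFrac.
Section TotalFrac.
Variable A : comNzRingType.

Definition regular (s : A) : bool := `[< GRing.lreg s >].

Inductive ratio := Ratio { frac :> A * A; _ : regular frac.2 }.

HB.instance Definition _ := [isSub for frac].
HB.instance Definition _ := [Choice of ratio by <:].

Lemma regularP s : reflect (GRing.lreg s) (regular s).
Proof. exact: asboolP. Qed.

Lemma regular1 : regular 1.
Proof. by apply/regularP; exact: lreg1. Qed.

Lemma regularM s t : regular s -> regular t -> regular (s * t).
Proof. by move=> /regularP ? /regularP ?; apply/regularP; exact: lregM. Qed.

Lemma denP (x : ratio) : regular (frac x).2.
Proof. by case: x. Qed.

Definition mk x s (rs : regular s) : ratio := @Ratio (x, s) rs.

Definition equivf (x y : ratio) := x.1 * y.2 == y.1 * x.2.

Lemma equivf_refl : reflexive equivf.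
Proof. by move=> x; rewrite /equivf. Qed.

Lemma equivf_sym : ssrbool.symmetric equivf.
Proof. by move=> x y; rewrite /equivf eq_sym. Qed.

Lemma equivf_trans : transitive equivf.
Proof.
move=> y x z /eqP xy /eqP yz; apply/eqP.
have /regularP ry := denP y; apply: ry => /=.
have -> : y.2 * (x.1 * z.2) = (x.1 * y.2) * z.2 by ring.
rewrite xy; have -> : y.1 * x.2 * z.2 = (y.1 * z.2) * x.2 by ring.
by rewrite yz; ring.
Qed.

Canonical equivf_equiv := EquivRel equivf equivf_refl equivf_sym equivf_trans.

Definition type := {eq_quot equivf}.

HB.instance Definition _ : EqQuotient _ equivf type := EqQuotient.on type.
HB.instance Definition _ := Choice.on type.

Lemma equivf_repr (x : ratio) :
  (repr (\pi_type x)).1 * x.2 = x.1 * (repr (\pi_type x)).2.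
Proof.
have /eqmodP/eqP : repr (\pi_type x) = x %[mod type] by rewrite reprK.
by [].
Qed.

Definition addf (x y : ratio) :=
  mk (x.1 * y.2 + y.1 * x.2) (regularM (denP x) (denP y)).
Definition add := lift_op2 type addf.
Definition oppf (x : ratio) := mk (- x.1) (denP x).
Definition opp := lift_op1 type oppf.
Definition mulf (x y : ratio) := mk (x.1 * y.1) (regularM (denP x) (denP y)).
Definition mul := lift_op2 type mulf.
Definition tofrac := lift_embed type (fun x => mk x regular1).

Canonical tofrac_pi_morph := PiEmbed tofrac.

Lemma pi_add : {morph \pi : x y / addf x y >-> add x y}.
Proof.
move=> x y; unlock add; apply/eqmodP; rewrite /= /equivf /=; apply/eqP.
have := equivf_repr y; have := equivf_repr x.
set x' := repr _; set y' := repr _ => ex ey.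
transitivity ((x.1 * x'.2) * (y.2 * y'.2) + (y.1 * y'.2) * (x.2 * x'.2)).
  by ring.
by rewrite -ex -ey; ring.
Qed.
Canonical pi_add_morph := PiMorph2 pi_add.

Lemma pi_opp : {morph \pi : x / oppf x >-> opp x}.
Proof.
move=> x; unlock opp; apply/eqmodP; rewrite /= /equivf /=; apply/eqP.
by rewrite !mulNr equivf_repr.
Qed.
Canonical pi_opp_morph := PiMorph1 pi_opp.

Lemma pi_mul : {morph \pi : x y / mulf x y >-> mul x y}.
Proof.
move=> x y; unlock mul; apply/eqmodP; rewrite /= /equivf /=; apply/eqP.
have := equivf_repr y; have := equivf_repr x.
set x' := repr _; set y' := repr _ => ex ey.
transitivity ((x.1 * x'.2) * (y.1 * y'.2)); first by ring.
by rewrite -ex -ey; ring.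
Qed.
Canonical pi_mul_morph := PiMorph2 pi_mul.

Fact addA : associative add.
Proof.
elim/quotW=> x; elim/quotW=> y; elim/quotW=> z; rewrite !piE.
by apply/eqmodP/eqP => /=; ring.
Qed.

Fact addC : commutative add.
Proof.
elim/quotW=> x; elim/quotW=> y; rewrite !piE.
by apply/eqmodP/eqP => /=; ring.
Qed.

Fact add0 : left_id (tofrac 0) add.
Proof. by elim/quotW=> x; rewrite !piE; apply/eqmodP/eqP => /=; ring. Qed.

Fact addN : left_inverse (tofrac 0) opp add.
Proof. by elim/quotW=> x; rewrite !piE; apply/eqmodP/eqP => /=; ring. Qed.

HB.instance Definition _ := GRing.isZmodule.Build type addA addC add0 addN.

Fact mulA : associative mul.
Proof.
elim/quotW=> x; elim/quotW=> y; elim/quotW=> z; rewrite !piE.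
by apply/eqmodP/eqP => /=; ring.
Qed.

Fact mulC : commutative mul.
Proof.
elim/quotW=> x; elim/quotW=> y; rewrite !piE.
by apply/eqmodP/eqP => /=; ring.
Qed.

Fact mul1 : left_id (tofrac 1) mul.
Proof. by elim/quotW=> x; rewrite !piE; apply/eqmodP/eqP => /=; ring. Qed.

Fact mulD : left_distributive mul add.
Proof.
elim/quotW=> x; elim/quotW=> y; elim/quotW=> z; rewrite !piE.
by apply/eqmodP/eqP => /=; ring.
Qed.

Fact tofrac_inj : injective tofrac.
Proof.
move=> x y; rewrite !piE => /eqmodP/eqP /=.
by rewrite !mulr1.
Qed.

Fact one_neq0 : tofrac 1 != tofrac 0.
Proof. by apply/eqP => /tofrac_inj/eqP; rewrite oner_eq0. Qed.

HB.instance Definition _ :=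
  GRing.Zmodule_isComNzRing.Build type mulA mulC mul1 mulD one_neq0.

Fact tofrac_zmod_morphism : zmod_morphism tofrac.
Proof.
move=> x y; rewrite -[tofrac x - tofrac y]/(add _ (opp _)) !piE.
by apply/eqmodP/eqP => /=; ring.
Qed.
HB.instance Definition _ :=
  GRing.isZmodMorphism.Build A type tofrac tofrac_zmod_morphism.

Fact tofrac_monoid_morphism : monoid_morphism tofrac.
Proof.
split=> // x y; rewrite -[tofrac x * tofrac y]/(mul _ _) !piE.
by apply/eqmodP/eqP => /=; ring.
Qed.
HB.instance Definition _ :=
  GRing.isMonoidMorphism.Build A type tofrac tofrac_monoid_morphism.

(* x / s, with the junk value x / 1 when s is a zero divisor *)
Definition div (x s : A) : type := \pi_type (insubd (mk x regular1) (x, s)).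

Lemma divK x s : GRing.lreg s -> tofrac s * div x s = tofrac x.
Proof.
move=> /regularP rs; rewrite -[LHS]/(mul _ _) /div /insubd insubT !piE.
by apply/eqmodP/eqP => /=; ring.
Qed.

Lemma tofrac_lreg s : GRing.lreg s -> GRing.lreg (tofrac s).
Proof.
move=> rs x y e; have := congr1 (mul (div 1 s)) e.
rewrite -[LHS]/(div 1 s * (tofrac s * x)) -[RHS]/(div 1 s * (tofrac s * y)).
by rewrite !mulrA ![div 1 s * _]mulrC divK // rmorph1 !mul1r.
Qed.

Lemma divP (z : type) : exists x s, GRing.lreg s /\ z = div x s.
Proof.
elim/quotW: z => -[[x s] /= rs]; exists x, s; split; first exact/regularP.
by rewrite /div /insubd insubT; congr \pi; apply: val_inj.
Qed.
End TotalFrac.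
End TotalFrac.
HB.export TotalFrac.

Notation totalfrac := TotalFrac.type.
Notation "x %:F" := (TotalFrac.tofrac x) : ring_scope.

Section MpolyAux.
Variables (K : comNzRingType) (m : nat).

Lemma lrmorph_horner_alg (A B : algType K) (e : {lrmorphism A -> B}) x p :
  e (horner_alg x p) = horner_alg (e x) p.
Proof.
elim/poly_ind: p => [|p a ih]; first by rewrite !raddf0.
by rewrite !rmorphD !rmorphM /= !horner_algX !horner_algC ih rmorph_alg.
Qed.

Lemma mderivU (i j : 'I_m) : ('X_j : {mpoly K[m]})^`M(i) = (i == j)%:R.
Proof.
rewrite mderivX mnm1E eq_sym; case: eqP => [->|_]; last by rewrite scale0r.
have -> : (U_(j) - U_(j) = 0)%MM.
  by apply/mnmP => k; rewrite mnmBE mnm0E subnn.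
by rewrite mpolyX0 scale1r.
Qed.

Lemma mderiv_horner_alg (i j : 'I_m) (p : {poly K}) :
  (horner_alg 'X_j p)^`M(i) = (i == j)%:R * horner_alg 'X_j p^`().
Proof.
elim/poly_ind: p => [|p a ih]; first by rewrite deriv0 !raddf0 mulr0.
rewrite !rmorphD !rmorphM /= horner_algX horner_algC derivMXaddC.
rewrite mderivD alg_mpolyC mderivC addr0 mderivM ih mderivU rmorphD rmorphM /=.
by rewrite horner_algX; ring.
Qed.

End MpolyAux.

Section MpolyLinear.
Variables (K : comNzRingType) (m : nat) (V : lmodType K) (h : 'X_{1..m} -> V).

Definition mlin (p : {mpoly K[m]}) : V := \sum_(k <- msupp p) p@_k *: h k.

Lemma mlinw (p : {mpoly K[m]}) d : (msize p <= d)%N ->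
  mlin p = \sum_(k : 'X_{1..m < d}) p@_k *: h k.
Proof.
move=> le_pd; pose I : subFinType _ := 'X_{1..m < d}.
rewrite /mlin (ssrcomplements.big_mksub I) ?msupp_uniq //=; first last.
  by move=> x /msize_mdeg_lt /leq_trans; apply.
by rewrite bigop.big_rmcond //= => j /memN_msupp_eq0 ->; rewrite scale0r.
Qed.

Lemma mlin_linear : linear mlin.
Proof.
move=> a p q.
pose d := maxn (msize (a *: p + q)) (maxn (msize p) (msize q)).
rewrite !(@mlinw _ d) ?leq_max ?leqnn ?orbT //.
rewrite scaler_sumr -big_split /=; apply: eq_bigr => k _.
by rewrite mcoeffD mcoeffZ scalerDl scalerA.
Qed.
HB.instance Definition _ := GRing.isLinear.Build K {mpoly K[m]} V _ mlin mlin_linear.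

Lemma mlinX k : mlin 'X_[k] = h k.
Proof. by rewrite /mlin msuppX big_seq1 mcoeffX eqxx scale1r. Qed.

End MpolyLinear.

Section Od.
Variables (C : numClosedFieldType) (a : 'I_4 -> C) (b : 'I_3 -> C) (c : C).

Definition Pod : {poly C} := \sum_(i < 4) a i *: 'X^i.
Definition Qod : {poly C} := \sum_(j < 3) b j *: 'X^j.

(* variables 0 and 1 stand for f and g *)
Local Notation X := ('X_0 : {mpoly C[2]}).
Local Notation Y := ('X_1 : {mpoly C[2]}).

Definition rel_od : {mpoly C[2]} :=
  (X + c%:MP) * Y ^+ 2 - (horner_alg X Pod + horner_alg X Qod * Y).

Lemma rel_od_root : exists v : 'I_2 -> C, rel_od.@[v] = 0.
Proof.
pose x := 1 - c.
have [y ye] := @solve_monicpoly C 2 (fun k => if k == 0%N then Pod.[x] else Qod.[x]) isT.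
move: ye; rewrite big_ord_recl big_ord1 /= expr0 expr1 mulr1 => ye.
pose v (i : 'I_2) := if i == 0 then x else y.
exists v; have hE p : (horner_alg X p).@[v] = p.[x].
  elim/poly_ind: p => [|p k ih]; first by rewrite raddf0 meval0 horner0.
  rewrite rmorphD rmorphM /= horner_algX horner_algC mevalD mevalM ih.
  by rewrite alg_mpolyC mevalC mevalXU hornerMXaddC.
rewrite /rel_od mevalB mevalM mevalD rmorphXn /= mevalD mevalM !hE !mevalXU.
by rewrite mevalC /v /= ye /x; ring.
Qed.

Definition ideal_od : {pred {mpoly C[2]}} := gen_ideal [:: rel_od].

Lemma ideal_od_closed : idealr_closed ideal_od.
Proof.
have [v ve] := rel_od_root; apply: (@gen_ideal_closed _ _ (meval v)) => r.
by rewrite inE => /eqP ->.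
Qed.
HB.instance Definition _ := isIdealr.Build _ ideal_od ideal_od_closed.

Definition Fod : comAlgType C := {ideal_quot ideal_od}.
Definition pi_od : {mpoly C[2]} -> Fod := \pi_{ideal_quot ideal_od}.
HB.instance Definition _ :=
  GRing.LRMorphism.copy pi_od (\pi_{ideal_quot ideal_od}).

Definition f_od : Fod := pi_od X.
Definition g_od : Fod := pi_od Y.

Lemma pi_od_eq0 p : (pi_od p == 0) = (p \in ideal_od).
Proof. by rewrite -(rmorph0 pi_od) -Quotient.idealrBE subr0. Qed.

Lemma repr_odK (x : Fod) : pi_od (repr x) = x.
Proof. exact: reprK. Qed.

Lemma pi_odC k : pi_od k%:MP = k%:A.
Proof. by rewrite -alg_mpolyC; exact: rmorph_alg. Qed.

Lemma pi_rel_od : pi_od rel_od = 0.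
Proof.
apply/eqP; rewrite pi_od_eq0; apply/gen_idealP.
by exists (fun=> 1); rewrite big_ord1 mul1r.
Qed.

Lemma od_relation :
  (f_od + c%:A) * g_od ^+ 2 = horner_alg f_od Pod + horner_alg f_od Qod * g_od.
Proof.
apply/eqP; rewrite -subr_eq0 -!(lrmorph_horner_alg pi_od) -(rmorph_alg pi_od).
rewrite alg_mpolyC /f_od /g_od -rmorphXn -!rmorphM -!rmorphD -!rmorphM -!rmorphB.
by apply/eqP; exact: pi_rel_od.
Qed.

(* D lifts to the derivation of C[f, g] taking the prescribed values on the
   variables; it annihilates rel_od. *)
Definition Df_poly : {mpoly C[2]} := 2%:R * (X + c%:MP) * Y - horner_alg X Qod.
Definition Dg_poly : {mpoly C[2]} :=
  horner_alg X Pod^`() + horner_alg X Qod^`() * Y - Y ^+ 2.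
Definition D_poly (p : {mpoly C[2]}) : {mpoly C[2]} :=
  p^`M(0) * Df_poly + p^`M(1) * Dg_poly.

Definition D_od (x : Fod) : Fod := pi_od (D_poly (repr x)).

Lemma D_polyM p q : D_poly (p * q) = D_poly p * q + p * D_poly q.
Proof. by rewrite /D_poly !mderivM; ring. Qed.

Lemma D_poly_linear : linear D_poly.
Proof.
by move=> k p q; rewrite /D_poly !mderivD !mderivZ -!mul_mpolyC; ring.
Qed.
HB.instance Definition _ :=
  GRing.isLinear.Build C {mpoly C[2]} {mpoly C[2]} _ D_poly D_poly_linear.

Lemma D_polyX : D_poly X = Df_poly.
Proof.
by rewrite /D_poly !mderivU /= mul1r mul0r addr0.
Qed.

Lemma D_polyY : D_poly Y = Dg_poly.
Proof.
by rewrite /D_poly !mderivU /= mul1r mul0r add0r.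
Qed.

Lemma D_poly_horner p : D_poly (horner_alg X p) = horner_alg X p^`() * Df_poly.
Proof. by rewrite /D_poly !mderiv_horner_alg /=; ring. Qed.

Lemma D_poly_rel : D_poly rel_od = 0.
Proof.
have Dc : D_poly c%:MP = 0 by rewrite /D_poly !mderivC !mul0r addr0.
have DD p q : D_poly (p + q) = D_poly p + D_poly q by exact: raddfD.
have -> : rel_od = (X + c%:MP) * (Y * Y) - (horner_alg X Pod + horner_alg X Qod * Y).
  by rewrite /rel_od expr2.
rewrite raddfB /= !DD !D_polyM !DD Dc D_polyX D_polyY !D_poly_horner.
by rewrite /Df_poly /Dg_poly; ring.
Qed.

Lemma D_od_pi p : D_od (pi_od p) = pi_od (D_poly p).
Proof.
apply/eqP; rewrite /D_od -subr_eq0 -rmorphB -raddfB /=.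
have : repr (pi_od p) - p \in ideal_od.
  by rewrite -pi_od_eq0 rmorphB /= repr_odK subrr.
move=> /gen_idealP[q ->]; rewrite big_ord1 /= D_polyM D_poly_rel mulr0 addr0.
by rewrite rmorphM /= pi_rel_od mulr0.
Qed.

Lemma D_od_linear : linear D_od.
Proof.
move=> k x y; rewrite -[x]repr_odK -[y]repr_odK -linearP !D_od_pi.
by rewrite D_poly_linear linearP.
Qed.
HB.instance Definition _ := GRing.isLinear.Build C Fod Fod _ D_od D_od_linear.

Lemma D_odM x y : D_od (x * y) = D_od x * y + x * D_od y.
Proof.
by rewrite -[x]repr_odK -[y]repr_odK -rmorphM !D_od_pi D_polyM rmorphD !rmorphM.
Qed.

Lemma D_od_f : D_od f_od = 2%:R * (f_od + c%:A) * g_od - horner_alg f_od Qod.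
Proof.
rewrite D_od_pi D_polyX /Df_poly -(lrmorph_horner_alg pi_od) rmorphB !rmorphM.
by rewrite rmorph_nat rmorphD /= pi_odC.
Qed.

Lemma D_od_g : D_od g_od =
  horner_alg f_od Pod^`() + horner_alg f_od Qod^`() * g_od - g_od ^+ 2.
Proof.
rewrite D_od_pi D_polyY /Dg_poly -!(lrmorph_horner_alg pi_od).
by rewrite rmorphB rmorphD rmorphM rmorphXn.
Qed.

(* The tensor square is presented as C[f1, g1, f2, g2] / (rel_od(f1, g1),
   rel_od(f2, g2)); tens_od_universal is its universal property. *)
Definition left_poly (p : {mpoly C[2]}) : {mpoly C[2 + 2]} :=
  p \mPo [tuple 'X_(lshift 2 i) | i < 2].
Definition right_poly (p : {mpoly C[2]}) : {mpoly C[2 + 2]} :=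
  p \mPo [tuple 'X_(rshift 2 i) | i < 2].
HB.instance Definition _ := GRing.LRMorphism.copy left_poly
  (comp_mpoly [tuple 'X_(lshift 2 i) | i < 2]).
HB.instance Definition _ := GRing.LRMorphism.copy right_poly
  (comp_mpoly [tuple 'X_(rshift 2 i) | i < 2]).

Definition ideal_tens_od : {pred {mpoly C[2 + 2]}} :=
  gen_ideal [:: left_poly rel_od; right_poly rel_od].

Lemma ideal_tens_od_closed : idealr_closed ideal_tens_od.
Proof.
have [v ve] := rel_od_root.
pose w (k : 'I_(2 + 2)) := match split k with inl i => v i | inr i => v i end.
apply: (@gen_ideal_closed _ _ (meval w)) => r.
rewrite !inE => /orP[] /eqP -> /=; rewrite comp_mpoly_meval -[RHS]ve.
- apply: meval_eq => i; rewrite tnth_mktuple mevalXU /w.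
  by rewrite (unsplitK (inl i : 'I_2 + 'I_2)).
- apply: meval_eq => i; rewrite tnth_mktuple mevalXU /w.
  by rewrite (unsplitK (inr i : 'I_2 + 'I_2)).
Qed.
HB.instance Definition _ := isIdealr.Build _ ideal_tens_od ideal_tens_od_closed.

Definition FFod : comAlgType C := {ideal_quot ideal_tens_od}.
Definition pi_tens : {mpoly C[2 + 2]} -> FFod := \pi_{ideal_quot ideal_tens_od}.
HB.instance Definition _ :=
  GRing.LRMorphism.copy pi_tens (\pi_{ideal_quot ideal_tens_od}).

Lemma pi_tens_eq0 p : (pi_tens p == 0) = (p \in ideal_tens_od).
Proof. by rewrite -(rmorph0 pi_tens) -Quotient.idealrBE subr0. Qed.

Lemma repr_tensK (x : FFod) : pi_tens (repr x) = x.
Proof. exact: reprK. Qed.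

Definition in1 (x : Fod) : FFod := pi_tens (left_poly (repr x)).
Definition in2 (x : Fod) : FFod := pi_tens (right_poly (repr x)).

Lemma in1_pi p : in1 (pi_od p) = pi_tens (left_poly p).
Proof.
apply/eqP; rewrite /in1 -subr_eq0 -!rmorphB /= pi_tens_eq0.
have : repr (pi_od p) - p \in ideal_od.
  by rewrite -pi_od_eq0 rmorphB /= repr_odK subrr.
move=> /gen_idealP[q ->]; rewrite big_ord1 /= rmorphM /=.
apply/gen_idealP; exists (fun i => if i == 0 then left_poly (q ord0) else 0).
by rewrite big_ord_recl big_ord1 /= mul0r addr0.
Qed.

Lemma in2_pi p : in2 (pi_od p) = pi_tens (right_poly p).
Proof.
apply/eqP; rewrite /in2 -subr_eq0 -!rmorphB /= pi_tens_eq0.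
have : repr (pi_od p) - p \in ideal_od.
  by rewrite -pi_od_eq0 rmorphB /= repr_odK subrr.
move=> /gen_idealP[q ->]; rewrite big_ord1 /= rmorphM /=.
apply/gen_idealP; exists (fun i => if i == 0 then 0 else right_poly (q ord0)).
by rewrite big_ord_recl big_ord1 /= mul0r add0r.
Qed.

Fact in1_linear : linear in1.
Proof.
move=> k x y; rewrite -[x]repr_odK -[y]repr_odK -linearP !in1_pi.
by rewrite /= !linearP.
Qed.
HB.instance Definition _ := GRing.isLinear.Build C Fod FFod _ in1 in1_linear.
Fact in1_monoid_morphism : monoid_morphism in1.
Proof.
split=> [|x y]; first by rewrite -(rmorph1 pi_od) in1_pi !rmorph1.
by rewrite -[x]repr_odK -[y]repr_odK -rmorphM !in1_pi !rmorphM.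
Qed.
HB.instance Definition _ :=
  GRing.isMonoidMorphism.Build Fod FFod in1 in1_monoid_morphism.

Fact in2_linear : linear in2.
Proof.
move=> k x y; rewrite -[x]repr_odK -[y]repr_odK -linearP !in2_pi.
by rewrite /= !linearP.
Qed.
HB.instance Definition _ := GRing.isLinear.Build C Fod FFod _ in2 in2_linear.
Fact in2_monoid_morphism : monoid_morphism in2.
Proof.
split=> [|x y]; first by rewrite -(rmorph1 pi_od) in2_pi !rmorph1.
by rewrite -[x]repr_odK -[y]repr_odK -rmorphM !in2_pi !rmorphM.
Qed.
HB.instance Definition _ :=
  GRing.isMonoidMorphism.Build Fod FFod in2 in2_monoid_morphism.

Definition tens (x y : Fod) : FFod := in1 x * in2 y.

Definition left_mnm (M : 'X_{1..2 + 2}) : 'X_{1..2} := [multinom M (lshift 2 i) | i < 2].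
Definition right_mnm (M : 'X_{1..2 + 2}) : 'X_{1..2} := [multinom M (rshift 2 i) | i < 2].
Definition join_mnm (m1 m2 : 'X_{1..2}) : 'X_{1..2 + 2} :=
  [multinom match split k with inl i => m1 i | inr i => m2 i end | k < 2 + 2].

Lemma left_join m1 m2 : left_mnm (join_mnm m1 m2) = m1.
Proof.
by apply/mnmP => i; rewrite !mnmE (unsplitK (inl i : 'I_2 + 'I_2)).
Qed.
Lemma right_join m1 m2 : right_mnm (join_mnm m1 m2) = m2.
Proof.
by apply/mnmP => i; rewrite !mnmE (unsplitK (inr i : 'I_2 + 'I_2)).
Qed.

Lemma polyX_split M :
  'X_[M] = left_poly 'X_[left_mnm M] * right_poly 'X_[right_mnm M].
Proof.
rewrite /left_poly /right_poly !comp_mpolyX mpolyXE_id big_split_ord /=.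
by congr (_ * _); apply: eq_bigr => i _; rewrite tnth_mktuple mnmE.
Qed.

Lemma polyX_join m1 m2 :
  left_poly 'X_[m1] * right_poly 'X_[m2] = 'X_[join_mnm m1 m2].
Proof. by rewrite polyX_split left_join right_join. Qed.

Lemma tens_od_universal (V : lmodType C) (B : Fod -> Fod -> V) :
  (forall y, linear (B^~ y)) -> (forall x, linear (B x)) ->
  exists L : FFod -> V, [/\ linear L, forall x y, L (tens x y) = B x y &
    forall L' : FFod -> V, linear L' -> (forall x y, L' (tens x y) = B x y) ->
      L' =1 L].
Proof.
move=> Bl Br.
pose B1 y := HB.pack_for {linear Fod -> V} (B^~ y)
  (GRing.isLinear.Build _ _ _ _ _ (Bl y)).
pose B2 x := HB.pack_for {linear Fod -> V} (B x)
  (GRing.isLinear.Build _ _ _ _ _ (Br x)).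
pose h M := B (pi_od 'X_[left_mnm M]) (pi_od 'X_[right_mnm M]).
pose l : {linear {mpoly C[2 + 2]} -> V} := mlin h.
have B0y y : B 0 y = 0 by exact: (linear0 (B1 y)).
have Bx0 x : B x 0 = 0 by exact: (linear0 (B2 x)).
have lE p q : l (left_poly p * right_poly q) = B (pi_od p) (pi_od q).
  elim/mpolyind: p => [|k m1 p _ _ ih]; first by rewrite !raddf0 mul0r raddf0 B0y.
  have /= B1E := Bl (pi_od q) k (pi_od 'X_[m1]) (pi_od p).
  rewrite !linearP /= B1E mulrDl -scalerAl linearP /= ih; congr (k *: _ + _).
  elim/mpolyind: q {B1E ih} => [|k' m2 q _ _ ih].
    by rewrite !raddf0 mulr0 raddf0 Bx0.
  have /= B2E := Br (pi_od 'X_[m1]) k' (pi_od 'X_[m2]) (pi_od q).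
  rewrite !linearP /= B2E mulrDr -scalerAr linearP /= ih; congr (k' *: _ + _).
  by rewrite polyX_join /l mlinX /h left_join right_join.
have l0 p : p \in ideal_tens_od -> l p = 0.
  move=> /gen_idealP[q ->]; rewrite big_ord_recl big_ord1 /= linearD /=.
  suff E r : l (r * left_poly rel_od) = 0 /\ l (r * right_poly rel_od) = 0.
    by rewrite (E _).1 (E _).2 addr0.
  split; rewrite [r]mpolyE mulr_suml linear_sum big1 // => M _ /=.
    rewrite -scalerAl linearZ /= polyX_split mulrAC -rmorphM lE rmorphM /=.
    by rewrite pi_rel_od mulr0 B0y scaler0.
  rewrite -scalerAl linearZ /= polyX_split -mulrA -rmorphM lE rmorphM /=.
  by rewrite pi_rel_od mulr0 Bx0 scaler0.
pose L (t : FFod) := l (repr t).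
have Lpi p : L (pi_tens p) = l p.
  apply/eqP; rewrite /L -subr_eq0 -linearB /=; apply/eqP/l0.
  by rewrite -pi_tens_eq0 rmorphB /= repr_tensK subrr.
exists L; split.
- move=> k s t; rewrite -[s]repr_tensK -[t]repr_tensK -linearP !Lpi.
  by rewrite linearP.
- move=> x y; rewrite -[x]repr_odK -[y]repr_odK /tens in1_pi in2_pi -rmorphM.
  by rewrite Lpi lE.
- move=> L' L'l L'B t; rewrite -[t]repr_tensK Lpi.
  pose L2 := HB.pack_for {linear FFod -> V} L'
    (GRing.isLinear.Build _ _ _ _ _ L'l).
  rewrite -[LHS]/(L2 _) [repr t]mpolyE !linear_sum /=; apply: eq_bigr => M _.
  rewrite !linearZ /= -[LHS]/(L2 _) linearZ /=; congr (_ *: _).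
  by rewrite -/(l _) polyX_split lE rmorphM /= -in1_pi -in2_pi L'B.
Qed.

Local Notation f1 := (in1 f_od).
Local Notation f2 := (in2 f_od).
Local Notation g1 := (in1 g_od).
Local Notation g2 := (in2 g_od).

Definition lambda_od_num : FFod :=
  (f1 + c%:A) * g1 + (f2 + c%:A) * g2
  - 2%:R^-1 *: horner_alg f1 Qod - 2%:R^-1 *: horner_alg f2 Qod.

Definition lambda_od : totalfrac FFod := TotalFrac.div lambda_od_num (f1 - f2).

Lemma lambda_odP :
  GRing.lreg (f1 - f2) -> (f1 - f2)%:F * lambda_od = lambda_od_num%:F.
Proof. exact: TotalFrac.divK. Qed.

(* x_(2i) = f^i and x_(2i+3) = f^i g; x_1 is unused. *)
Definition x_od (m : nat) : Fod :=
  if odd m then f_od ^+ (m - 3)./2 * g_od else f_od ^+ m./2.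

(* The variables 0, 1, ..., n - 1 of {mpoly C[n]} stand for
   x_0, x_2, ..., x_n. *)
Definition gen_od n (k : 'I_n) : Fod :=
  x_od (if val k == 0%N then 0%N else k.+1).

(* Identification of the linear forms with F_n. *)
Definition lin_od n (p : {mpoly C[n]}) : Fod :=
  \sum_(k < n) p@_U_(k) *: gen_od k.

(* Identification of the quadratic forms with the symmetric tensors of
   F_n (x) F_n, normalized by sym2_odM. *)
Definition sym2_od n (p : {mpoly C[n]}) : FFod :=
  \sum_(k < n) \sum_(l < n | (k <= l)%N)
     p@_(U_(k) + U_(l)) *: (tens (gen_od k) (gen_od l) + tens (gen_od l) (gen_od k)).

Fact lin_od_linear n : linear (@lin_od n).
Proof.
move=> k p q; rewrite scaler_sumr -big_split /=; apply: eq_bigr => i _.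
by rewrite mcoeffD mcoeffZ scalerDl scalerA.
Qed.
HB.instance Definition _ n :=
  GRing.isLinear.Build C {mpoly C[n]} Fod _ (@lin_od n) (@lin_od_linear n).

Fact sym2_od_linear n : linear (@sym2_od n).
Proof.
move=> k p q; rewrite scaler_sumr -big_split /=; apply: eq_bigr => i _.
rewrite scaler_sumr -big_split /=; apply: eq_bigr => j _.
by rewrite mcoeffD mcoeffZ scalerDl scalerA.
Qed.
HB.instance Definition _ n :=
  GRing.isLinear.Build C {mpoly C[n]} FFod _ (@sym2_od n) (@sym2_od_linear n).

Lemma lin_odX n (k : 'I_n) : lin_od 'X_k = gen_od k.
Proof.
rewrite /lin_od (bigD1 k) //= mcoeffXU eqxx scale1r big1 ?addr0 // => i ik.
by rewrite mcoeffXU eq_sym (negPf ik) scale0r.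
Qed.

Lemma addU_eq n (i j k l : 'I_n) : (i <= j)%N -> (k <= l)%N ->
  ((U_(i) + U_(j))%MM == (U_(k) + U_(l))%MM) = (i == k) && (j == l).
Proof.
move=> ij kl; apply/eqP/andP => [e|[/eqP-> /eqP->//]].
have ik : i = k.
  apply/val_inj; case: (ltngtP i k) => // h.
  - move/mnmP/(_ i): e; rewrite !mnmDE !mnm1E eqxx.
    rewrite -[k == i]/(val k == val i) -[l == i]/(val l == val i).
    by rewrite !gtn_eqF // (leq_trans h).
  - move/mnmP/(_ k): e; rewrite !mnmDE !mnm1E eqxx.
    rewrite -[i == k]/(val i == val k) -[j == k]/(val j == val k).
    by rewrite !gtn_eqF // (leq_trans h).
by move: e; rewrite ik => /addmI/eqP; rewrite eq_mnm1 eqxx.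
Qed.

Lemma sym2_odXX n (i j : 'I_n) : sym2_od ('X_i * 'X_j) =
  tens (gen_od i) (gen_od j) + tens (gen_od j) (gen_od i).
Proof.
wlog ij : i j / (i <= j)%N.
  move=> H; case: (leqP i j) => [/H//|/ltnW/H]; by rewrite mulrC addrC.
rewrite -mpolyXD /sym2_od (bigD1 i) //= (bigD1 j) //=.
rewrite mcoeffX eqxx scale1r [X in _ + X + _]big1 => [|l /andP[il lj]].
  rewrite addr0 [X in _ + X]big1 ?addr0 // => k ki.
  by rewrite big1 // => l kl; rewrite mcoeffX addU_eq // eq_sym (negPf ki) scale0r.
by rewrite mcoeffX addU_eq // eqxx eq_sym (negPf lj) scale0r.
Qed.

Lemma dhomog1E n (p : {mpoly C[n]}) :
  p \is 1.-homog -> p = \sum_(k < n) p@_U_(k) *: 'X_k.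
Proof.
move=> hp; apply/mpolyP => m; rewrite raddf_sum /=.
have [dm|dm] := eqVneq (mdeg m) 1%N; last first.
  rewrite (dhomog_nemf_coeff hp dm) big1 // => k _.
  rewrite mcoeffZ mcoeffX; case: eqP => [e|]; last by rewrite mulr0.
  by move: dm; rewrite -e mdeg1.
have /mdeg1P[i /eqP im] : mdeg m == 1%N by apply/eqP.
rewrite im (bigD1 i) //= mcoeffZ mcoeffXU eqxx mulr1 big1 ?addr0 // => k ki.
by rewrite mcoeffZ mcoeffXU (negPf ki) mulr0.
Qed.

Lemma sym2_odM n (p q : {mpoly C[n]}) : p \is 1.-homog -> q \is 1.-homog ->
  sym2_od (p * q) = tens (lin_od p) (lin_od q) + tens (lin_od q) (lin_od p).
Proof.
move=> hp hq; rewrite {1}(dhomog1E hp) {1}(dhomog1E hq).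
have E1 r : in1 (lin_od r) = \sum_(k < n) r@_U_(k) *: in1 (gen_od k).
  by rewrite linear_sum; apply: eq_bigr => k _; rewrite linearZ.
have E2 r : in2 (lin_od r) = \sum_(k < n) r@_U_(k) *: in2 (gen_od k).
  by rewrite linear_sum; apply: eq_bigr => k _; rewrite linearZ.
rewrite /tens !E1 !E2 !big_distrlr /= [X in _ = _ + X]exchange_big /=.
rewrite linear_sum -big_split /=; apply: eq_bigr => k _.
rewrite linear_sum -big_split /=; apply: eq_bigr => l _.
rewrite -scalerAl -scalerAr !linearZ /= sym2_odXX /tens.
rewrite -!scalerAl -!scalerAr !scalerDr !scalerA.
by congr (_ + _); congr (_ *: _); rewrite mulrC.
Qed.

Definition bracket_od (n : nat) (phi psi : Fod) : totalfrac FFod :=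
  (n%:R * lambda_od + (g2 - g1 + (2%:R^-1 * b ord_max) *: (f1 - f2))%:F)
    * (in1 phi * in2 psi - in1 psi * in2 phi)%:F
  + (in1 phi * in2 (D_od psi) + in2 phi * in1 (D_od psi)
     - in1 psi * in2 (D_od phi) - in2 psi * in1 (D_od phi))%:F.

(* br restricts on F_n to bracket_od; in particular bracket_od takes its values
   in the image of the quadratic forms. *)
Definition induced_od n (br : {mpoly C[n]} -> {mpoly C[n]} -> {mpoly C[n]}) :=
  forall phi psi : {mpoly C[n]}, phi \is 1.-homog -> psi \is 1.-homog ->
    br phi psi \is 2.-homog /\
    (sym2_od (br phi psi))%:F = bracket_od n (lin_od phi) (lin_od psi).

End Od.

Section Poisson.
Variables (C : numClosedFieldType) (n : nat).

Definition bracket := {mpoly C[n]} -> {mpoly C[n]} -> {mpoly C[n]}.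

Record is_poisson (br : bracket) : Prop := IsPoisson {
  poisson_linear : forall q, linear (br^~ q);
  poisson_antisym : forall p q, br p q = - br q p;
  poisson_leibniz : forall p q r, br p (q * r) = br p q * r + q * br p r;
  poisson_jacobi : forall p q r,
    br p (br q r) + br q (br r p) + br r (br p q) = 0
}.

Definition is_quadratic (br : bracket) : Prop :=
  forall i j : 'I_n, br 'X_i 'X_j \is 2.-homog.

Definition compatible (br br' : bracket) : Prop :=
  forall u : C, is_poisson (fun p q => br p q + u *: br' p q).

End Poisson.

(* Indices of the brackets {,}_0, {,}_{i,1}, {,}_{j,2} and {,}_3. *)
Variant od_label := Lab0 | Lab1 of 'I_4 | Lab2 of 'I_3 | Lab3.

(* Main.v *)
Require Import Defs.
From HB Require Import structures.
From mathcomp Require Import all_boot all_order all_algebra ring_quotient.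
From mathcomp Require Import boolp reals complex mpoly.
From mathcomp Require Import ring zify.

Set Implicit Arguments.
Unset Strict Implicit.
Unset Printing Implicit Defensive.

Import Order.TTheory GRing.Theory Num.Theory.

Local Open Scope ring_scope.

(** Write F for the coordinate algebra, x_1 and x_2 for the two copies of x in
    F (x) F, and
      K_12 = n lambda + g_2 - g_1 + b_2/2 (f_1 - f_2),
    which is antisymmetric in the two points.  The bracket of phi and psi is
      K_12 (phi_1 psi_2 - psi_1 phi_2) + phi_1 D psi_2 + phi_2 D psi_1
        - psi_1 D phi_2 - psi_2 D phi_1.

    Values.  On two monomials f^i g^d the numerator is divisible by f_1 - f_2, and
    the quotient can be written down once the relation has replaced
    (f + c) g^2 by P + Q g.  This gives structure constants that are affine in
    the parameters (component, weighted_bracket_num); the parts are the nine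
    brackets.  The products of generators that leave F_n have coefficients that
    vanish exactly because n is the dimension of F_n (component_trunc).

    Jacobi identity.  A cubic polynomial is a symmetric function of three points
    of the curve.  In the Jacobiator of phi, psi, chi, seen as such a function,
    every term with a derivative of phi, psi or chi and every product of two
    kernels cancels by the antisymmetry of K; what is left is the cyclic sum of
    (D_2 + D_3) K_23 times the alternating function of phi, psi, chi
    (cyclic_form_eq0).  That sum is zero because (D_1 + D_2) K_12 = h_1 - h_2 for a
    function h on the curve (kernel_flow).  Indeed y = (f + c) g - Q/2 satisfies
    y^2 = R(f) with R = (f + c) P + Q^2/4 of degree at most 4, D f = 2 y and
    lambda = (y_1 + y_2)/(f_1 - f_2), so the claim is an identity about quartics
    (branch_poly_sum).

    From points to polynomials.  When the equation of the curve has two distinct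
    roots g for almost every f, the points of the curve span the dual of F_n.  A
    cubic polynomial whose third derivatives vanish along all triples of points
    with distinct f is then zero (points_dird_eq0).  This applies to all
    weights of the nine brackets off a hypersurface; the Jacobiator is quadratic
    in the weights, so it vanishes for all of them (od_bracket_dense).  Hence every
    linear combination of the nine brackets is Poisson (od_bracket_poisson),
    which contains the pairwise compatibility.

    Uniqueness.  The coordinates on the linearly independent f^i, f^i g show that
    a quadratic form is determined by its symmetric tensor (sym2_od_inj), and a
    Poisson bracket by its values on the variables (poisson_unique). *)

(** * Structure constants *)

(** (d, i) stands for f^i g^d. *)
Definition mon := (bool * nat)%type.

(** Everything below is linear in mu, where mu x y is the product of the generators
    of the monomials x and y.  The same formulas are used for polynomials, for
    symmetric tensors, and for the numbers obtained at a pair of points. *)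
Section StructureConstants.
Variables (C : numClosedFieldType) (N : C).

Section Values.
Variables (V : lmodType C) (mu : mon -> mon -> V).
Local Notation half := (2%:R^-1 : C).

(** The expansion of (f_1^j f_2^i - f_1^i f_2^j) / (f_1 - f_2), with factors g^d and
    g^e and with the second exponent raised by r; it is empty for j <= i, so the
    quotient for all i and j is wsum d e i j r - wsum d e j i r. *)
Definition wsum d e i j r : V :=
  \sum_(i <= k < j) mu (d, k) (e, i + j - k.+1 + r)%N.

(** Half of the bracket of f^i and f^j, which is completed by antisymmetry.  The
    constant N is the coefficient of lambda; the wsum come from lambda, the terms
    with r = 2 from b_2/2 (f_1 - f_2), and all others from D and g_2 - g_1.  At an
    exponent 0 the predecessor is harmless: its coefficient vanishes. *)
Definition half_ff (K : od_label) (i j : nat) : V :=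
  match K with
  | Lab0 => (1 + 2 * j)%:R *: mu (false, i) (true, j) - N *: wsum false true i j 1
  | Lab1 _ => 0
  | Lab2 r => (half * N) *: wsum false false i j r
      - j%:R *: mu (false, i) (false, j.-1 + r)%N
      + (half *+ (r == 2 :> nat)) *: mu (false, i.+1) (false, j)
  | Lab3 => (2 * j)%:R *: mu (false, i) (true, j.-1) - N *: wsum false true i j 0
  end.

Definition half_gg (K : od_label) (i j : nat) : V :=
  match K with
  | Lab0 | Lab3 => 0
  | Lab1 r => (2 * j + r)%:R *: mu (true, i) (false, (j + r).-1)
      - N *: wsum true false i j r
  | Lab2 r => (j + r)%:R *: mu (true, i) (true, (j + r).-1)
      - (half * N) *: wsum true true i j r
      + (half *+ (r == 2 :> nat)) *: mu (true, i.+1) (true, j)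
  end.

Definition component_fg (K : od_label) (i j : nat) : V :=
  match K with
  | Lab0 => - (1 + 2 * i)%:R *: mu (true, i) (true, j)
      - (half * N) *: (wsum true true i.+1 j 0 - wsum true true j i.+1 0)
  | Lab1 r => (2 * j + r)%:R *: mu (false, i) (false, (j + r).-1)
      - (half * N)
        *: (wsum false false i (j + r) 0 - wsum false false (j + r) i 0)
  | Lab2 r => (j + r)%:R *: mu (false, i) (true, (j + r).-1)
      + i%:R *: mu (true, j) (false, i.-1 + r)%N
      - (half * N) *: (\sum_(k < r) mu (false, i + (r.-1 - k))%N (true, j + k)%N)
      + (half *+ (r == 2 :> nat))
        *: (mu (false, i.+1) (true, j) - mu (false, i) (true, j.+1))
  | Lab3 => - (2 * i)%:R *: mu (true, j) (true, i.-1)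
      - (half * N) *: (wsum true true i j 0 - wsum true true j i 0)
  end.

Definition component (K : od_label) (x y : mon) : V :=
  match x, y with
  | (false, i), (false, j) => half_ff K i j - half_ff K j i
  | (false, i), (true, j) => component_fg K i j
  | (true, i), (false, j) => - component_fg K j i
  | (true, i), (true, j) => half_gg K i j - half_gg K j i
  end.

Definition weighted (s : od_label -> C) (x y : mon) : V :=
  s Lab0 *: component Lab0 x y + \sum_(r < 4) s (Lab1 r) *: component (Lab1 r) x y
  + \sum_(r < 3) s (Lab2 r) *: component (Lab2 r) x y + s Lab3 *: component Lab3 x y.

Lemma component_anti K x y : component K x y = - component K y x.
Proof. by case: x y => [[] i] [[] j] /=; rewrite ?opprB ?opprK. Qed.

Lemma weighted_anti s x y : weighted s x y = - weighted s y x.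
Proof.
rewrite /weighted ![component _ x y]component_anti.
under eq_bigr do rewrite component_anti scalerN.
under [X in _ + X + _]eq_bigr do rewrite component_anti scalerN.
by rewrite !sumrN !scalerN !opprD.
Qed.

End Values.

Lemma wsum_linear (V V' : lmodType C) (L : {linear V -> V'}) mu d e i j r :
  L (wsum mu d e i j r) = wsum (fun x y => L (mu x y)) d e i j r.
Proof. by rewrite /wsum linear_sum. Qed.

(** A linear map acts on the products only; for every way to read a quadratic
    form this transports the structure constants. *)
Lemma component_linear (V V' : lmodType C) (L : {linear V -> V'}) mu K x y :
  L (component mu K x y) = component (fun x y => L (mu x y)) K x y.
Proof.
have LD u v : L (u + v) = L u + L v by exact: linearD.
have LN u : L (- u) = - L u by exact: linearN.
have LZ k u : L (k *: u) = k *: L u by exact: linearZ.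
have L0 : L 0 = 0 by exact: linear0.
case: x y => [[] i] [[] j]; case: K => [|r|r|] /=.
all: rewrite ?(LD, LN, LZ, L0, wsum_linear) //.
all: by rewrite linear_sum.
Qed.

Lemma weighted_linear (V V' : lmodType C) (L : {linear V -> V'}) mu s x y :
  L (weighted mu s x y) = weighted (fun x y => L (mu x y)) s x y.
Proof.
have LZ k K : L (k *: component mu K x y) = k *: component (fun x y => L (mu x y)) K x y.
  by rewrite linearZ component_linear.
rewrite /weighted !linearD !linear_sum !LZ.
under eq_bigr do rewrite LZ.
by under [X in _ + X + _]eq_bigr do rewrite LZ.
Qed.

Lemma eq_weighted (V : lmodType C) (mu nu : mon -> mon -> V) s x y :
  (forall p q, mu p q = nu p q) -> weighted mu s x y = weighted nu s x y.
Proof. by move=> E; congr weighted; apply/funext => p; apply/funext. Qed.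

Lemma weighted_comb (V : lmodType C) (mu : mon -> mon -> V) s s' (k : C) x y :
  weighted mu (fun K => s K + k * s' K) x y =
  weighted mu s x y + k *: weighted mu s' x y.
Proof.
have AC (p p' q q' r r' t t' : V) : p + p' + (q + q') + (r + r') + (t + t') =
    p + q + r + t + (p' + q' + r' + t').
  by rewrite (addrACA p) (addrACA (p + q)) (addrACA (p + q + r)).
rewrite /weighted !scalerDr !scaler_sumr !scalerDl.
under eq_bigr do rewrite scalerDl -scalerA.
under [X in _ + _ + X + _ = _]eq_bigr do rewrite scalerDl -scalerA.
by rewrite !big_split -!scalerA AC.
Qed.
End StructureConstants.

(** * Truncation to F_n *)
Definition in_range (m : nat) (x : mon) : bool :=
  if x.1 then (x.2 < m)%N else (x.2 <= m)%N.

(** Here n = 2m + 1.  The formulas mention products with f^(m+1) or f^m g only when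
    one of the arguments is of top degree; the term from lambda and those from D,
    g_2 - g_1 and b_2/2 (f_1 - f_2) then cancel because N = n. *)
Section Truncation.
Variables (C : numClosedFieldType) (m : nat) (V : lmodType C).
Variables (mu : mon -> mon -> V).
Hypothesis mu_sym : forall p q, mu p q = mu q p.
Hypothesis mu_out : forall p q, in_range m p -> in_range m q -> mu p q = 0.

Local Notation N := (m.*2.+1%:R : C).
Local Notation half := (2%:R^-1 : C).

Let NE : N = m%:R * 2 + 1. Proof. by rewrite -natr1 -muln2 natrM. Qed.

Let wsum0 d e i j r :
  (forall k, (i <= k < j)%N ->
     in_range m (d, k) /\ in_range m (e, i + j - k.+1 + r)%N) ->
  wsum mu d e i j r = 0.
Proof.
move=> H; rewrite /wsum big_nat_cond big1 // => k /andP[/H[? ?] _].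
exact: mu_out.
Qed.

Let wsum1 d e i j r : (i < j)%N ->
  (forall k, (i < k < j)%N ->
     in_range m (d, k) /\ in_range m (e, i + j - k.+1 + r)%N) ->
  wsum mu d e i j r = mu (d, i) (e, j.-1 + r)%N.
Proof.
move=> ij H; rewrite /wsum big_ltn // big_nat_cond big1 ?addr0.
  by congr (mu _ (_, _)); lia.
by move=> k /andP[/H[? ?] _]; exact: mu_out.
Qed.

Local Ltac range :=
  rewrite /in_range /=; try (match goal with r : 'I__ |- _ => have := ltn_ord r end); lia.

Let component_ff_trunc K i j : (i < j <= m)%N ->
  component N mu K (false, i) (false, j) = 0.
Proof.
move=> /andP[ij jm].
case: K => [|r|r|] /=.
- rewrite wsum1 // => [|k]; last by range.
  rewrite [wsum _ _ _ j i _]wsum0 => [|k]; last by lia.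
  rewrite [mu (false, j) _]mu_out; [|range..].
  rewrite !scaler0 !subr0 addn1 prednK ?(leq_ltn_trans _ ij) // -scalerBl.
  have [jlt|jge] := ltnP j m; first by rewrite mu_out ?scaler0 //; range.
  have -> : j = m by lia.
  by rewrite add1n mul2n subrr scale0r.
- by rewrite subr0.
- rewrite [wsum _ _ _ j i _]wsum0 => [|k]; last by lia.
  have -> : i%:R *: mu (false, j) (false, i.-1 + r)%N = 0.
    case: i ij => [|i] ij; first by rewrite scale0r.
    by rewrite mu_out ?scaler0 //; range.
  rewrite [mu (false, i.+1) _]mu_out; [|range..].
  case: r => [[|[|[|//]]] ?] /=.
  1,2: rewrite wsum0 => [|k]; last by range.
  1,2: by rewrite !mulr0n !scale0r [mu _ _]mu_out ?scaler0 ?addr0 ?subr0 ?oppr0 //; range.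
  rewrite wsum1 // => [|k]; last by range.
  rewrite [mu (false, j.+1) _]mu_sym addn2 prednK ?(leq_ltn_trans _ ij) //.
  rewrite !scaler0 subr0 addr0 add0r -scalerBl -scalerBl.
  have [jlt|jge] := ltnP j m; first by rewrite mu_out ?scaler0 //; range.
  have -> : j = m by lia.
  rewrite [half * _ - _ - _](_ : _ = 0) ?scale0r // mulr1n.
  by rewrite NE; field.
- rewrite wsum0 => [|k]; last by range.
  rewrite wsum0 => [|k]; last by range.
  by rewrite !mu_out ?scaler0 ?subr0 //; range.
Qed.

Let component_gg_trunc K i j : (i < j < m)%N ->
  component N mu K (true, i) (true, j) = 0.
Proof.
move=> /andP[ij jm].
have j_gt0 : (0 < j)%N by lia.
case: K => [|r|r|] /=; rewrite ?subr0 //.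
- rewrite [wsum _ _ _ j i _]wsum0 => [|k]; last by lia.
  rewrite [mu (true, j) _]mu_out; [|range..].
  have [r2|r3] := ltnP r 3.
    rewrite wsum0 => [|k]; last by range.
    by rewrite mu_out ?scaler0 ?subr0 //; range.
  rewrite wsum1 // => [|k]; last by range.
  have -> : nat_of_ord r = 3%N by have := ltn_ord r; lia.
  have -> : (j.-1 + 3 = (j + 3).-1)%N by lia.
  rewrite !scaler0 !subr0 -scalerBl.
  have [jlt|jge] := ltnP j.+1 m; first by rewrite mu_out ?scaler0 //; range.
  have -> : (2 * j + 3 = m.*2.+1)%N by lia.
  by rewrite subrr scale0r.
- rewrite [wsum _ _ _ j i _]wsum0 => [|k]; last by lia.
  rewrite [mu (true, j) (true, _)]mu_out; [|range..].
  rewrite [mu (true, i.+1) _]mu_out; [|range..].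
  case: r => [[|[|[|//]]] ?] /=.
  1,2: rewrite wsum0 => [|k]; last by range.
  1,2: by rewrite !mulr0n !scale0r [mu _ _]mu_out ?scaler0 ?addr0 ?subr0 ?oppr0 //; range.
  rewrite wsum1 // => [|k]; last by range.
  have -> : (j.-1 + 2 = j.+1)%N by lia.
  rewrite [mu (true, j.+1) _]mu_sym addn2 /=.
  rewrite !scaler0 subr0 addr0 add0r -scalerBl -scalerBl.
  have [jlt|jge] := ltnP j.+1 m; first by rewrite mu_out ?scaler0 //; range.
  have mE : m%:R = j%:R + 1 :> C by rewrite natr1; congr _%:R; lia.
  rewrite [_ - _ - _](_ : _ = 0) ?scale0r // mulr1n.
  by rewrite NE mE -[j.+2]addn2 !natrD; field.
Qed.

Let component_fg_trunc K i j : (i <= m)%N -> (j < m)%N ->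
  component N mu K (false, i) (true, j) = 0.
Proof.
move=> im jm; case: K => [|r|r|] /=.
- have [ij|ij] := ltnP i j.
    rewrite wsum0 => [|k]; last by range.
    rewrite wsum0 => [|k]; last by range.
    by rewrite mu_out ?scaler0 ?subrr ?scaler0 ?subr0 //; range.
  rewrite wsum0 => [|k]; last by range.
  have [ilt|ige] := ltnP i m.
    rewrite wsum0 => [|k]; last by range.
    by rewrite mu_out ?scaler0 ?subrr ?scaler0 ?subr0 //; range.
  have -> : i = m by lia.
  rewrite /wsum big_ltn ?ltnS 1?ltnW // big_nat_recr //= big_nat_cond big1; last first.
    by move=> k /andP[? _]; rewrite mu_out //; range.
  have -> : (j + m.+1 - j.+1 + 0 = m)%N by lia.
  have -> : (j + m.+1 - m.+1 + 0 = j)%N by lia.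
  rewrite !add0r [mu (true, j) _]mu_sym scalerN opprK scalerDr -!scalerDl.
  rewrite [- _ + _](_ : _ = 0) ?scale0r //.
  by rewrite NE natrD natrM; field.
- have [r2|r3] := ltnP r 3.
    rewrite wsum0 => [|k]; last by range.
    rewrite wsum0 => [|k]; last by range.
    by rewrite mu_out ?scaler0 ?subrr ?scaler0 ?subr0 //; range.
  have -> : nat_of_ord r = 3%N by have := ltn_ord r; lia.
  have [jlt|jge] := ltnP j.+1 m.
    rewrite wsum0 => [|k]; last by range.
    rewrite wsum0 => [|k]; last by range.
    by rewrite mu_out ?scaler0 ?subrr ?scaler0 ?subr0 //; range.
  rewrite [wsum _ _ _ (j + 3) i _]wsum0 => [|k]; last by range.
  rewrite /wsum big_ltn; last by lia.
  rewrite (_ : (j + 3 = j.+3)%N) ?addn3 // big_nat_recr /=; last by lia.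
  rewrite big_nat_cond big1; last by move=> k /andP[? _]; rewrite mu_out //; range.
  have -> : (i + j.+3 - i.+1 + 0 = j.+2)%N by lia.
  have -> : (i + j.+3 - j.+3 + 0 = i)%N by lia.
  rewrite add0r subr0 [mu (false, j.+2) _]mu_sym scalerDr -scalerDl -scalerBl.
  have mE : m%:R = j%:R + 1 :> C by rewrite natr1; congr _%:R; lia.
  rewrite [_ - _](_ : _ = 0) ?scale0r //.
  by rewrite NE mE -[(2 * j).+3]addn3 natrD natrM; field.
- have -> : i%:R *: mu (true, j) (false, i.-1 + r)%N =
      (i%:R *+ (r == 2 :> nat)) *: mu (false, i.+1) (true, j).
    case: i im => [|i] im; first by rewrite mul0rn !scale0r.
    case: r => [[|[|[|//]]] ?] /=; rewrite ?mulr0n ?scale0r ?mulr1n.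
    1,2: by rewrite mu_out ?scaler0 //; range.
    by rewrite mu_sym addn2.
  case: r => [[|[|[|//]]] ?] /=.
  + by rewrite big_ord0 !mulr0n !scale0r mu_out ?scaler0 ?subr0 ?addr0 //; range.
  + rewrite big_ord1 !mulr0n !scale0r !mu_out ?scaler0 ?subr0 ?addr0 //; range.
  rewrite big_ord_recl big_ord1 /= /bump /= [(i + (1 - 0))%N]addn1 [(j + 0)%N]addn0.
  rewrite [(i + (1 - _))%N]addn0 [(j + (1 + 0))%N]addn1 addn2 /=.
  rewrite !mulr1n !scalerDr scalerN.
  set X := mu (false, i.+1) _; set Y := mu _ _.
  rewrite [X in X = _](_ : _ =
    (i%:R - half * N + half) *: X + (j.+2%:R - half * N - half) *: Y); last first.
    rewrite [_ + i%:R *: X]addrC !scalerDl !scaleNr opprD.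
    by rewrite (addrACA (i%:R *: X)) (addrACA (i%:R *: X - _)).
  have -> : (i%:R - half * N + half) *: X = 0.
    have [ilt|ige] := ltnP i m; first by rewrite /X mu_out ?scaler0 //; range.
    have -> : i = m by lia.
    by rewrite [_ - _ + _](_ : _ = 0) ?scale0r // NE; field.
  have [jlt|jge] := ltnP j.+1 m; first by rewrite /Y mu_out ?scaler0 ?addr0 //; range.
  have mE : m%:R = j%:R + 1 :> C by rewrite natr1; congr _%:R; lia.
  rewrite [_ - _ - _](_ : _ = 0) ?scale0r ?addr0 //.
  by rewrite NE mE -[j.+2]addn2 !natrD; field.
- rewrite wsum0 => [|k]; last by range.
  rewrite wsum0 => [|k]; last by range.
  by rewrite mu_out ?scaler0 ?subrr ?scaler0 ?subr0 //; range.
Qed.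

Lemma component_trunc K x y : in_range m x -> in_range m y ->
  component N mu K x y = 0.
Proof.
case: x y => [[] i] [[] j] hi hj.
- have [ij|ij|->] := ltngtP i j; last by rewrite /= subrr.
    by rewrite component_gg_trunc ?ij.
  by rewrite component_anti component_gg_trunc ?oppr0 ?ij.
- by rewrite component_anti component_fg_trunc ?oppr0.
- by rewrite component_fg_trunc.
- have [ij|ij|->] := ltngtP i j; last by rewrite /= subrr.
    by rewrite component_ff_trunc ?ij.
  by rewrite component_anti component_ff_trunc ?oppr0 ?ij.
Qed.

End Truncation.

(** Hence mu may be changed freely on monomials that are not in F_n.  This permits
    any convention for the missing generators and, at points, the untruncated
    powers of f. *)
Lemma eq_weighted_in (C : numClosedFieldType) (m : nat) (V : lmodType C)
    (mu nu : mon -> mon -> V) (s : od_label -> C) x y :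
  (forall p q, mu p q = mu q p) -> (forall p q, nu p q = nu q p) ->
  (forall p q, in_range m p -> in_range m q -> mu p q = nu p q) ->
  in_range m x -> in_range m y ->
  weighted m.*2.+1%:R mu s x y = weighted m.*2.+1%:R nu s x y.
Proof.
move=> mus nus E hx hy.
pose two p q : V * V := (mu p q, nu p q).
have fstE K : component m.*2.+1%:R mu K x y = (component m.*2.+1%:R two K x y).1.
  by rewrite (component_linear _ fst).
have sndE K : component m.*2.+1%:R nu K x y = (component m.*2.+1%:R two K x y).2.
  by rewrite (component_linear _ snd).
pose L (z : V * V) := z.1 - z.2.
have Ll : linear L.
  by move=> k u v; rewrite /L /= opprD addrACA -scalerBr.
pose LL := HB.pack_for {linear (V * V)%type -> V} L (GRing.isLinear.Build _ _ _ _ _ Ll).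
have KE K : component m.*2.+1%:R mu K x y = component m.*2.+1%:R nu K x y.
  apply/eqP; rewrite -subr_eq0 fstE sndE -[_ - _]/(LL _) component_linear.
  apply/eqP/component_trunc => // p q.
    by rewrite /= /L /= mus nus.
  by move=> hp hq; rewrite /= /L /= E // subrr.
rewrite /weighted !KE; under eq_bigr do rewrite KE.
by under [X in _ + X + _]eq_bigr do rewrite KE.
Qed.

(** * Structure constants at a pair of points *)
Definition mon_val (A : pzRingType) (f g : A) (x : mon) : A := f ^+ x.2 * g ^+ x.1.

Definition mon_der (A : pzRingType) (f g f' g' : A) (x : mon) : A :=
  x.2%:R * f ^+ x.2.-1 * g ^+ x.1 * f' + x.1%:R * f ^+ x.2 * g'.

Definition od_weight (C : Type) (one : C) (a : 'I_4 -> C) (b : 'I_3 -> C) (c : C)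
    (K : od_label) : C :=
  match K with Lab0 => one | Lab1 r => a r | Lab2 r => b r | Lab3 => c end.

Section TwoPoints.
Variables (C : numClosedFieldType) (N : C) (A : comAlgType C) (u G v H : A).

(** The normalization of the symmetric tensors, at the points (u, G) and (v, H). *)
Definition sym_val (x y : mon) : A :=
  mon_val u G x * mon_val v H y + mon_val u G y * mon_val v H x.

Lemma sym_valC x y : sym_val x y = sym_val y x.
Proof. by rewrite /sym_val addrC. Qed.

Local Notation half := (2%:R^-1 : C).
Local Notation phi := (in_alg A).

Lemma wsum_val d e i j r : (i <= j)%N ->
  (u - v) * wsum sym_val d e i j r =
  (u ^+ j * v ^+ i - u ^+ i * v ^+ j) * (G ^+ d * H ^+ e * v ^+ r + H ^+ d * G ^+ e * u ^+ r).
Proof.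
move=> ij; pose F k := u ^+ k * v ^+ (i + j - k).
have FE k : (i <= k < j)%N ->
    (u - v) * (u ^+ k * v ^+ (i + j - k.+1)) = F k.+1 - F k.
  move=> /andP[_ kj]; rewrite /F.
  have -> : (i + j - k = (i + j - k.+1).+1)%N by lia.
  by rewrite !exprS; ring.
have E1 : (u - v) * \sum_(i <= k < j) u ^+ k * v ^+ (i + j - k.+1) = F j - F i.
  rewrite -(telescope_sumr F ij) mulr_sumr big_nat_cond [RHS]big_nat_cond.
  by apply: eq_bigr => k /andP[/FE].
have E2 : \sum_(i <= k < j) v ^+ k * u ^+ (i + j - k.+1) =
          \sum_(i <= k < j) u ^+ k * v ^+ (i + j - k.+1).
  rewrite big_nat_rev /= big_nat_cond [RHS]big_nat_cond.
  apply: eq_bigr => k /andP[? _]; rewrite mulrC.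
  by congr (_ ^+ _ * _ ^+ _); lia.
have -> : wsum sym_val d e i j r =
    G ^+ d * H ^+ e * v ^+ r * (\sum_(i <= k < j) u ^+ k * v ^+ (i + j - k.+1))
  + H ^+ d * G ^+ e * u ^+ r * (\sum_(i <= k < j) v ^+ k * u ^+ (i + j - k.+1)).
  rewrite !mulr_sumr -big_split /=; apply: eq_bigr => k _.
  by rewrite /sym_val /mon_val /= !exprD; ring.
rewrite E2 -mulrDl mulrCA E1 /F addnK addKn; ring.
Qed.

Lemma wdiff_val d e i j r :
  (u - v) * (wsum sym_val d e i j r - wsum sym_val d e j i r) =
  (u ^+ j * v ^+ i - u ^+ i * v ^+ j) * (G ^+ d * H ^+ e * v ^+ r + H ^+ d * G ^+ e * u ^+ r).
Proof.
wlog ij : i j / (i <= j)%N => [W|].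
  have [/W//|/ltnW/W E] := leqP i j.
  transitivity (- ((u - v) * (wsum sym_val d e j i r - wsum sym_val d e i j r))).
    by ring.
  by rewrite E; ring.
have [->|ne] := eqVneq i j; first by rewrite subrr; ring.
by rewrite [wsum _ _ _ j i _](big_geq ij) subr0 wsum_val.
Qed.

Local Notation dpow x k := (k%:R * x ^+ k.-1).

Lemma scale_in_alg k (x : A) : k *: x = phi k * x.
Proof. by rewrite /= mulr_algl. Qed.

Lemma in_alg_nat k : phi k%:R = k%:R.
Proof. exact: rmorph_nat. Qed.

Lemma in_alg_halfN : phi N = 2 * phi (half * N).
Proof. by rewrite -in_alg_nat -rmorphM mulVKf // pnatr_eq0. Qed.

Lemma in_alg_halfMn k : k%:R = 2 * phi (half *+ k).
Proof.
by rewrite -!in_alg_nat -rmorphM -[half *+ k]mulr_natr mulVKf // pnatr_eq0.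
Qed.

Lemma dpowE (x : A) k : k%:R * x ^+ k = x * dpow x k.
Proof. by case: k => [|k]; rewrite ?mul0r ?mulr0 // exprS; ring. Qed.

Lemma dpowDl (x : A) k r : k%:R * x ^+ (k + r).-1 = dpow x k * x ^+ r.
Proof. by case: k => [|k]; rewrite ?mul0r // addSn /= exprD mulrA. Qed.

Lemma dpowDr (x : A) k r : r%:R * x ^+ (k + r).-1 = x ^+ k * dpow x r.
Proof. by rewrite addnC dpowDl mulrC. Qed.

(** wdiff_val with a monomial on the left, the form in which ring can use it. *)
Let wdiff_ring d e i j r : u * wsum sym_val d e i j r =
  v * wsum sym_val d e i j r + u * wsum sym_val d e j i r
  - v * wsum sym_val d e j i r
  + (u ^+ j * v ^+ i - u ^+ i * v ^+ j)
    * (G ^+ d * H ^+ e * v ^+ r + H ^+ d * G ^+ e * u ^+ r).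
Proof. rewrite -wdiff_val; ring. Qed.

Let svE d e i j : sym_val (d, i) (e, j) =
  u ^+ i * G ^+ d * (v ^+ j * H ^+ e) + u ^+ j * G ^+ e * (v ^+ i * H ^+ d).
Proof. by []. Qed.

Local Ltac expand := rewrite /= !svE !scale_in_alg ?in_alg_nat.

(** Multiplying by 2 (f_1 - f_2) clears the halves and telescopes the sums, one
    label at a time. *)
Section FF.
Variables i j : nat.
Local Notation U k := (u ^+ k).
Local Notation V k := (v ^+ k).
Local Notation U' k := (dpow u k).
Local Notation V' k := (dpow v k).
Local Notation D := (U j * V i - U i * V j).

Lemma component_ff_Lab0 : 2 * (u - v) * component N sym_val Lab0 (false, i) (false, j) =
  - (phi N * (2 * u * G + 2 * v * H) + (u - v) * (2 * H - 2 * G)) * D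
  + 4 * (u - v) * (U i * (j%:R * V j) * H + V i * (j%:R * U j) * G
                   - U j * (i%:R * V i) * H - V j * (i%:R * U i) * G).
Proof.
have := wdiff_ring false true i j 1; rewrite /= => E.
expand; ring: E.
Qed.

Lemma component_ff_Lab2 r : 2 * (u - v) * component N sym_val (Lab2 r) (false, i) (false, j) =
  phi N * D * (u ^+ r + v ^+ r)
  - 2 * (u - v) * (U i * V' j * v ^+ r + V i * U' j * u ^+ r
                   - U j * V' i * v ^+ r - V j * U' i * u ^+ r)
  - (r == 2 :> nat)%:R * (u - v) ^+ 2 * D.
Proof.
have := wdiff_ring false false i j r; rewrite /= => E.
expand; rewrite in_alg_halfN (in_alg_halfMn (r == 2 :> nat)) !exprD !exprS.
ring: E.
Qed.

Lemma component_ff_Lab3 : 2 * (u - v) * component N sym_val Lab3 (false, i) (false, j) =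
  - 2 * phi N * D * (G + H)
  + 4 * (u - v) * (U i * V' j * H + V i * U' j * G
                   - U j * V' i * H - V j * U' i * G).
Proof.
have := wdiff_ring false true i j 0; rewrite /= => E.
expand; ring: E.
Qed.

Lemma component_fg_Lab0 : 2 * (u - v) * component N sym_val Lab0 (false, i) (true, j) =
  - 2 * (u - v) * G * H * (U i * V j + U j * V i
       + 2 * ((i%:R * U i) * V j + (i%:R * V i) * U j))
  - 2 * phi N * G * H * (v * U j * V i - u * U i * V j).
Proof.
have := wdiff_ring true true i.+1 j 0; rewrite /= !exprS => E.
expand; rewrite in_alg_halfN; ring: E.
Qed.

Lemma component_fg_Lab1 r : 2 * (u - v) * component N sym_val (Lab1 r) (false, i) (true, j) =
  2 * (u - v) * (U i * (2 * (V' j * V r) + V j * V' r)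
                 + V i * (2 * (U' j * U r) + U j * U' r))
  - 2 * phi N * (U j * U r * V i - U i * V j * V r).
Proof.
have := wdiff_ring false false i (j + r) 0; rewrite /= !exprD => E.
expand; rewrite in_alg_halfN -!dpowDl -!dpowDr; ring: E.
Qed.

Lemma component_fg_Lab2 (r : 'I_3) :
  2 * (u - v) * component N sym_val (Lab2 r) (false, i) (true, j) =
  2 * (u - v) * (U i * (V' j * V r + V j * V' r) * H + V i * (U' j * U r + U j * U' r) * G
                 + U j * G * (V' i * V r) + V j * H * (U' i * U r))
  - phi N * (U r - V r) * (U i * V j * H + V i * U j * G)
  + (r == 2 :> nat)%:R * (u - v) ^+ 2 * (U i * V j * H - V i * U j * G).
Proof.
pose S (x y : A) := \sum_(k < r) x ^+ (r.-1 - k) * y ^+ k.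
have SE x y : (x - y) * S x y = x ^+ r - y ^+ r.
  by rewrite subrXX; congr (_ * _); apply: eq_bigr => k _; congr (_ ^+ _ * _); lia.
have sumE : \sum_(k < r) sym_val (false, i + (r.-1 - k))%N (true, j + k)%N =
    U i * V j * H * S u v + V i * U j * G * S v u.
  rewrite !mulr_sumr -big_split /=; apply: eq_bigr => k _.
  by rewrite svE !exprD; ring.
have -> : u ^+ r - v ^+ r = (u - v) * S u v by rewrite SE.
have E2 : u * S u v = v * S u v + u * S v u - v * S v u.
  transitivity (v * S u v + u * S v u - v * S v u
                + ((u - v) * S u v + (v - u) * S v u)); first by ring.
  by rewrite !SE; ring.
rewrite in_alg_halfN (in_alg_halfMn (r == 2 :> nat)) -!(dpowDl _ j) -!dpowDr.
rewrite /= sumE !svE !scale_in_alg !in_alg_nat !exprD !exprS.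
ring: E2.
Qed.

Lemma component_fg_Lab3 : 2 * (u - v) * component N sym_val Lab3 (false, i) (true, j) =
  - 4 * (u - v) * G * H * (U' i * V j + V' i * U j)
  - 2 * phi N * G * H * D.
Proof.
have := wdiff_ring true true i j 0; rewrite /= => E.
expand; rewrite in_alg_halfN; ring: E.
Qed.

Lemma component_gg_Lab1 r : 2 * (u - v) * component N sym_val (Lab1 r) (true, i) (true, j) =
  2 * (u - v) * (U i * (2 * (V' j * V r) + V j * V' r) * G
                 + V i * (2 * (U' j * U r) + U j * U' r) * H
                 - U j * (2 * (V' i * V r) + V i * V' r) * G
                 - V j * (2 * (U' i * U r) + U i * U' r) * H)
  - 2 * phi N * D * (G * V r + H * U r).
Proof.
have := wdiff_ring true false i j r; rewrite /= => E.
expand; rewrite -!dpowDl -!dpowDr; ring: E.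
Qed.

Lemma component_gg_Lab2 r : 2 * (u - v) * component N sym_val (Lab2 r) (true, i) (true, j) =
  2 * (u - v) * G * H * (U i * (V' j * V r + V j * V' r) + V i * (U' j * U r + U j * U' r)
                 - U j * (V' i * V r + V i * V' r) - V j * (U' i * U r + U i * U' r))
  - phi N * G * H * D * (V r + U r)
  - (r == 2 :> nat)%:R * (u - v) ^+ 2 * G * H * D.
Proof.
have := wdiff_ring true true i j r; rewrite /= => E.
expand; rewrite in_alg_halfN (in_alg_halfMn (r == 2 :> nat)) -!dpowDl -!dpowDr !exprS.
ring: E.
Qed.
End FF.
End TwoPoints.

(** * The bracket of two monomials on the curve *)
Section Curve.
Variables (C : numClosedFieldType) (a : 'I_4 -> C) (b : 'I_3 -> C) (c : C).
Variable (A : comAlgType C).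
Implicit Types f g : A.

Definition on_curve f g : Prop :=
  (f + c%:A) * g ^+ 2 = horner_alg f (Pod a) + horner_alg f (Qod b) * g.

Definition curve_df f g : A := 2 * (f + c%:A) * g - horner_alg f (Qod b).

Definition curve_dg f g : A :=
  horner_alg f (Pod a)^`() + horner_alg f (Qod b)^`() * g - g ^+ 2.

Definition curve_der f g (x : mon) : A :=
  mon_der f g (curve_df f g) (curve_dg f g) x.

Local Notation phi := (in_alg A).

Lemma horner_Pod f : horner_alg f (Pod a) = \sum_(r < 4) phi (a r) * f ^+ r.
Proof.
rewrite /Pod rmorph_sum; apply: eq_bigr => r _.
by rewrite -mul_polyC rmorphM rmorphXn /= horner_algC horner_algX.
Qed.

Lemma horner_Qod f : horner_alg f (Qod b) = \sum_(r < 3) phi (b r) * f ^+ r.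
Proof.
rewrite /Qod rmorph_sum; apply: eq_bigr => r _.
by rewrite -mul_polyC rmorphM rmorphXn /= horner_algC horner_algX.
Qed.

Lemma horner_Pod' f :
  horner_alg f (Pod a)^`() = \sum_(r < 4) phi (a r) * (r%:R * f ^+ r.-1).
Proof.
rewrite /Pod raddf_sum rmorph_sum; apply: eq_bigr => r _.
rewrite /= derivZ derivXn -mul_polyC rmorphM rmorphMn rmorphXn /=.
by rewrite horner_algC horner_algX mulr_natl.
Qed.

Lemma horner_Qod' f :
  horner_alg f (Qod b)^`() = \sum_(r < 3) phi (b r) * (r%:R * f ^+ r.-1).
Proof.
rewrite /Qod raddf_sum rmorph_sum; apply: eq_bigr => r _.
rewrite /= derivZ derivXn -mul_polyC rmorphM rmorphMn rmorphXn /=.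
by rewrite horner_algC horner_algX mulr_natl.
Qed.

Section Pairing.
Variables (N : C) (u G v H : A).
Hypotheses (relu : on_curve u G) (relv : on_curve v H).

(** 2 (f_1 - f_2) K_12 *)
Definition kernel_num : A :=
  phi N * (2 * ((u + c%:A) * G + (v + c%:A) * H)
           - horner_alg u (Qod b) - horner_alg v (Qod b))
  + (u - v) * (2 * (H - G) + phi (b ord_max) * (u - v)).

Definition bracket_num (x y : mon) : A :=
  kernel_num * (mon_val u G x * mon_val v H y - mon_val u G y * mon_val v H x)
  + 2 * (u - v) * (mon_val u G x * curve_der v H y + mon_val v H x * curve_der u G y
       - mon_val u G y * curve_der v H x - mon_val v H y * curve_der u G x).

Local Notation T := (weighted N (sym_val u G v H) (od_weight 1 a b c)).

Let TE x y : 2 * (u - v) * T x y =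
  2 * (u - v) * component N (sym_val u G v H) Lab0 x y
  + \sum_(r < 4) phi (a r) * (2 * (u - v) * component N (sym_val u G v H) (Lab1 r) x y)
  + \sum_(r < 3) phi (b r) * (2 * (u - v) * component N (sym_val u G v H) (Lab2 r) x y)
  + phi c * (2 * (u - v) * component N (sym_val u G v H) Lab3 x y).
Proof.
rewrite /weighted !mulrDr !mulr_sumr /= scale1r.
congr (_ + _ + _ + _).
- by apply: eq_bigr => r _; rewrite scale_in_alg mulrCA.
- by apply: eq_bigr => r _; rewrite scale_in_alg mulrCA.
- by rewrite scale_in_alg mulrCA.
Qed.

Let b2E : ord_max = lift ord0 (lift ord0 ord0) :> 'I_3.
Proof. exact: val_inj. Qed.

Let bracket_ff i j :
  2 * (u - v) * T (false, i) (false, j) = bracket_num (false, i) (false, j).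
Proof.
rewrite TE component_ff_Lab0 component_ff_Lab3 !dpowE.
under eq_bigr do rewrite /= subr0 mulr0 mulr0.
under [X in _ + X + _]eq_bigr do rewrite component_ff_Lab2.
rewrite /bracket_num /kernel_num /curve_der /mon_der /mon_val /=.
rewrite /curve_df !horner_Qod b2E !big_ord_recl !big_ord0 /= /bump /=.
ring.
Qed.

Let relE f g : on_curve f g ->
  horner_alg f (Pod a) = (f + c%:A) * g ^+ 2 - horner_alg f (Qod b) * g.
Proof. by move->; ring. Qed.

Let horner_PQ f := (horner_Pod f, horner_Qod f, horner_Pod' f, horner_Qod' f).

(** The two correction terms are multiples of the relation at (u, G) and (v, H);
    their coefficients are those of (u + c) G^2 and (v + c) H^2 in the bracket. *)
Let bracket_fg i j :
  2 * (u - v) * T (false, i) (true, j) = bracket_num (false, i) (true, j).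
Proof.
set k := bracket_num _ _.
have -> : k = k
    - (4 * (u - v) * v ^+ i * (j%:R * u ^+ j.-1) - 2 * phi N * u ^+ j * v ^+ i)
      * ((u + c%:A) * G ^+ 2 - horner_alg u (Pod a) - horner_alg u (Qod b) * G)
    - (4 * (u - v) * u ^+ i * (j%:R * v ^+ j.-1) + 2 * phi N * u ^+ i * v ^+ j)
      * ((v + c%:A) * H ^+ 2 - horner_alg v (Pod a) - horner_alg v (Qod b) * H).
  by rewrite (relE relu) (relE relv); ring.
rewrite TE component_fg_Lab0 component_fg_Lab3 !dpowE.
under eq_bigr do rewrite component_fg_Lab1.
under [X in _ + X + _]eq_bigr do rewrite component_fg_Lab2.
rewrite /k /bracket_num /kernel_num /curve_der /mon_der /mon_val /=.
rewrite /curve_df /curve_dg !horner_PQ b2E !big_ord_recl !big_ord0 /= /bump /=.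
ring.
Qed.

Let bracket_gg i j :
  2 * (u - v) * T (true, i) (true, j) = bracket_num (true, i) (true, j).
Proof.
pose D := u ^+ j * v ^+ i - u ^+ i * v ^+ j.
set k := bracket_num _ _.
have -> : k = k
    - (4 * (u - v) * H * (v ^+ i * (j%:R * u ^+ j.-1) - v ^+ j * (i%:R * u ^+ i.-1))
       - 2 * phi N * D * H)
      * ((u + c%:A) * G ^+ 2 - horner_alg u (Pod a) - horner_alg u (Qod b) * G)
    - (4 * (u - v) * G * (u ^+ i * (j%:R * v ^+ j.-1) - u ^+ j * (i%:R * v ^+ i.-1))
       - 2 * phi N * D * G)
      * ((v + c%:A) * H ^+ 2 - horner_alg v (Pod a) - horner_alg v (Qod b) * H).
  by rewrite (relE relu) (relE relv); ring.
rewrite TE /= !subrr !mulr0.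
under eq_bigr do rewrite component_gg_Lab1.
under [X in _ + X + _]eq_bigr do rewrite component_gg_Lab2.
rewrite /k /D /bracket_num /kernel_num /curve_der /mon_der /mon_val /=.
rewrite /curve_df /curve_dg !horner_PQ b2E !big_ord_recl !big_ord0 /= /bump /=.
ring.
Qed.

Lemma weighted_bracket_num x y : 2 * (u - v) * T x y = bracket_num x y.
Proof.
case: x y => [[] i] [[] j]; first exact: bracket_gg.
- rewrite weighted_anti mulrN bracket_fg /bracket_num; ring.
- exact: bracket_fg.
- exact: bracket_ff.
Qed.
End Pairing.
End Curve.

(** * Poisson brackets on a polynomial ring *)
Section Derivations.
Variables (C : numClosedFieldType) (n : nat).
Implicit Types p q r : {mpoly C[n]}.

Lemma derivation_eq0 (d : {mpoly C[n]} -> {mpoly C[n]}) :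
  linear d -> (forall p q, d (p * q) = d p * q + p * d q) ->
  (forall i, d 'X_i = 0) -> forall p, d p = 0.
Proof.
move=> dl dM dX.
pose L := HB.pack_for {linear {mpoly C[n]} -> {mpoly C[n]}} d
  (GRing.isLinear.Build _ _ _ _ _ dl).
have d1 : d 1 = 0.
  by apply: (addrI (d 1)); rewrite addr0 -{3}[1]mulr1 dM mulr1 mul1r.
have dXn i k : d ('X_i ^+ k) = 0.
  by elim: k => [|k IH]; rewrite ?expr0 // exprS dM dX IH mul0r mulr0 addr0.
have dmon (m : 'X_{1..n}) : d 'X_[m] = 0.
  rewrite mpolyXE_id; apply: (big_ind (fun p => d p = 0)) => // p q dp dq.
  by rewrite dM dp dq mul0r mulr0 addr0.
move=> p; rewrite -[d]/(L : _ -> _) [p]mpolyE linear_sum big1 // => m _.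
by rewrite linearZ /= dmon scaler0.
Qed.

Section Poisson.
Variable br : bracket C n.
Hypotheses (brl : forall q, linear (br^~ q)) (brA : forall p q, br p q = - br q p).
Hypothesis brM : forall p q r, br p (q * r) = br p q * r + q * br p r.

Let brr p : linear (br p).
Proof. by move=> k q r; rewrite brA brl opprD -scalerN -!(brA p). Qed.

Let brD p q r : br p (q + r) = br p q + br p r.
Proof. by have := brr p 1 q r; rewrite !scale1r. Qed.

Let br0 p : br p 0 = 0.
Proof. by apply: (addrI (br p 0)); rewrite -brD !addr0. Qed.

Let brN p q : br p (- q) = - br p q.
Proof. by apply: (addrI (br p q)); rewrite -brD !subrr. Qed.

Definition jacobiator p q r := br p (br q r) + br q (br r p) + br r (br p q).

Lemma jacobiatorC p q r : jacobiator q r p = jacobiator p q r.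
Proof. by rewrite /jacobiator addrC addrA. Qed.

Let jacobiator_linear p q : linear (jacobiator p q).
Proof.
have brL k r s t : br (k *: r + s) t = k *: br r t + br s t by exact: brl.
by move=> k r s; rewrite /jacobiator !(brr, brL) -!mul_mpolyC; ring.
Qed.

Let jacobiatorM p q r s : jacobiator p q (r * s) =
  jacobiator p q r * s + r * jacobiator p q s.
Proof.
rewrite /jacobiator.
rewrite [br r (br p q)]brA [br s (br p q)]brA [br (r * s) (br p q)]brA.
rewrite [br (r * s) p]brA [br r p]brA [br s p]brA.
by rewrite !(brM, brD, brN); ring.
Qed.

(** The Jacobiator is a derivation in its last argument and cyclically invariant. *)
Lemma poisson_generators :
  (forall i j k, jacobiator 'X_i 'X_j 'X_k = 0) -> is_poisson br.
Proof.
move=> J0.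
have ext p q : (forall k, jacobiator p q 'X_k = 0) -> forall r, jacobiator p q r = 0.
  by move=> H r; exact: (derivation_eq0 (jacobiator_linear p q) (jacobiatorM p q) H r).
have J1 i j r : jacobiator 'X_i 'X_j r = 0 by exact: ext.
have J2 r i q : jacobiator r 'X_i q = 0.
  by apply: ext => j; rewrite -jacobiatorC.
split=> // p q r; rewrite -/(jacobiator p q r).
by apply: ext => i; rewrite -jacobiatorC J2.
Qed.
End Poisson.

Lemma poisson_unique (br br' : bracket C n) : is_poisson br -> is_poisson br' ->
  (forall i j, br 'X_i 'X_j = br' 'X_i 'X_j) -> forall p q, br p q = br' p q.
Proof.
case=> brl brA brM _ [brl' brA' brM' _] E.
have step p : (forall j, br p 'X_j = br' p 'X_j) -> forall q, br p q = br' p q.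
  move=> Ep q; apply/eqP; rewrite -subr_eq0; apply/eqP.
  apply: (derivation_eq0 (d := fun q => br p q - br' p q)) => {q} [k q r|q r|j].
  - rewrite brA brA' brl brl' [br p q]brA [br p r]brA [br' p q]brA' [br' p r]brA'.
    by rewrite -!mul_mpolyC; ring.
  - by rewrite brM brM'; ring.
  - by rewrite Ep subrr.
move=> p q; apply: (step) => j; rewrite brA brA' (step 'X_j) //.
Qed.

Variable T : 'I_n -> 'I_n -> {mpoly C[n]}.

Definition biderivation : bracket C n :=
  fun p q => \sum_k \sum_l p^`M(k) * q^`M(l) * T k l.

Lemma biderivationX k l : biderivation 'X_k 'X_l = T k l.
Proof.
rewrite /biderivation (bigD1 k) //= (bigD1 l) //= !mderivU !eqxx !mul1r.
rewrite [X in _ + X + _]big1 ?addr0 => [|j jl]; last first.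
  by rewrite mderivU (negPf jl) mulr0 mul0r.
rewrite big1 ?addr0 // => i ik; rewrite big1 // => j _.
by rewrite mderivU (negPf ik) !mul0r.
Qed.

Lemma biderivation_linear q : linear (biderivation^~ q).
Proof.
move=> c p r; rewrite scaler_sumr -big_split /=; apply: eq_bigr => k _.
rewrite scaler_sumr -big_split /=; apply: eq_bigr => l _.
by rewrite mderivD mderivZ !mulrDl -!scalerAl.
Qed.

Lemma biderivationM p q r :
  biderivation p (q * r) = biderivation p q * r + q * biderivation p r.
Proof.
rewrite mulr_sumr mulr_suml -big_split /=; apply: eq_bigr => k _.
rewrite mulr_sumr mulr_suml -big_split /=; apply: eq_bigr => l _.
by rewrite mderivM; ring.
Qed.

Lemma biderivation_anti : (forall k l, T k l = - T l k) ->
  forall p q, biderivation p q = - biderivation q p.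
Proof.
move=> TA p q; rewrite /biderivation exchange_big -sumrN /=.
apply: eq_bigr => k _; rewrite -sumrN; apply: eq_bigr => l _.
by rewrite TA; ring.
Qed.
End Derivations.

(** * The family of brackets *)
Lemma poly_vanish (C : numFieldType) (p r : {poly C}) : r != 0 ->
  (forall t, r.[t] != 0 -> p.[t] = 0) -> p = 0.
Proof.
move=> r0 H; suff: p * r = 0 by move/eqP; rewrite mulf_eq0 (negPf r0) orbF => /eqP.
apply: (@roots_geq_poly_eq0 _ _ [seq i%:R | i <- iota 0 (size (p * r))]).
- apply/allP => _ /mapP[i _ ->]; rewrite /root hornerM.
  by have [->|/H->] := eqVneq r.[i%:R] 0; rewrite ?mulr0 ?mul0r.
- by rewrite map_inj_uniq ?iota_uniq //; exact: (mulrIn (oner_neq0 _)).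
- by rewrite size_map size_iota.
Qed.

(** The variable k = 0 is f^0; k = 2i - 1 is x_(2i) = f^i for i > 0, and k = 2i + 2
    is x_(2i+3) = f^i g. *)
Definition gen_mon (k : nat) : mon :=
  if k == 0%N then (false, 0%N)
  else if odd k then (false, k.+1./2) else (true, k./2.-1).

Definition mon_pos (x : mon) : nat := if x.1 then x.2.*2.+2 else x.2.*2.-1.

Lemma gen_mon_pos x : gen_mon (mon_pos x) = x.
Proof.
case: x => [[] [|i]] //=; rewrite /gen_mon /mon_pos /= ?negbK ?odd_double //=.
  by rewrite doubleK.
by rewrite doubleK.
Qed.

Lemma mon_pos_gen k : mon_pos (gen_mon k) = k.
Proof.
rewrite /gen_mon /mon_pos; case: eqP => //; have := odd_double_half k.
by rewrite /= !uphalf_half; case: (odd k) => /=; lia.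
Qed.

Section Brackets.
Variables (C : numClosedFieldType) (m : nat).
Local Notation n := m.*2.+1.
Local Notation N := (n%:R : C).

Lemma gen_mon_range (k : 'I_n) : in_range m (gen_mon k).
Proof.
have := ltn_ord k; rewrite /gen_mon /in_range; case: eqP => //= k_neq0.
have := odd_double_half k.
by rewrite /= !uphalf_half; case: (odd k) => /=; lia.
Qed.

Definition mon_ord (x : mon) : 'I_n := inord (mon_pos x).

Lemma gen_monK (k : 'I_n) : mon_ord (gen_mon k) = k.
Proof. by rewrite /mon_ord mon_pos_gen inord_val. Qed.

Lemma mon_ordK x : in_range m x -> gen_mon (mon_ord x) = x.
Proof.
move=> hx; rewrite inordK ?gen_mon_pos //.
by move: hx; case: x => [[] i]; rewrite /in_range /mon_pos /=; lia.
Qed.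

(** Out of range mon_ord takes a default value, which has no effect by
    eq_weighted_in. *)
Definition mon_mul (x y : mon) : {mpoly C[n]} := 'X_(mon_ord x) * 'X_(mon_ord y).

Definition label_bracket (K : od_label) : bracket C n :=
  biderivation (fun k l => component N mon_mul K (gen_mon k) (gen_mon l)).

Definition od_bracket (s : od_label -> C) : bracket C n :=
  biderivation (fun k l => weighted N mon_mul s (gen_mon k) (gen_mon l)).

Lemma od_bracketE s p q : od_bracket s p q =
  s Lab0 *: label_bracket Lab0 p q + \sum_(r < 4) s (Lab1 r) *: label_bracket (Lab1 r) p q
  + \sum_(r < 3) s (Lab2 r) *: label_bracket (Lab2 r) p q
  + s Lab3 *: label_bracket Lab3 p q.
Proof.
rewrite /od_bracket /label_bracket /biderivation.
rewrite !scaler_sumr.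
under [X in _ + X + _ + _]eq_bigr do rewrite scaler_sumr.
under [X in _ + _ + X + _]eq_bigr do rewrite scaler_sumr.
rewrite [X in _ + X + _ + _]exchange_big [X in _ + _ + X + _]exchange_big -!big_split /=.
apply: eq_bigr => k _; rewrite !scaler_sumr.
under [X in _ + X + _ + _]eq_bigr do rewrite scaler_sumr.
under [X in _ + _ + X + _]eq_bigr do rewrite scaler_sumr.
rewrite [X in _ + X + _ + _]exchange_big [X in _ + _ + X + _]exchange_big -!big_split /=.
apply: eq_bigr => l _; rewrite /weighted !mulrDr !mulr_sumr -!scalerAr.
by congr (_ + _ + _ + _); apply: eq_bigr => r _; rewrite scalerAr.
Qed.

Lemma od_bracket_comb s s' k p q :
  od_bracket (fun K => s K + k * s' K) p q = od_bracket s p q + k *: od_bracket s' p q.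
Proof.
rewrite /od_bracket /biderivation scaler_sumr -big_split /=; apply: eq_bigr => i _.
rewrite scaler_sumr -big_split /=; apply: eq_bigr => j _.
by rewrite weighted_comb mulrDr scalerAr.
Qed.

Lemma od_bracketZ s k p q :
  od_bracket (fun K => k * s K) p q = k *: od_bracket s p q.
Proof.
have z0 : od_bracket (fun=> 0) p q = 0.
  apply: (addIr (od_bracket (fun=> 0) p q)).
  have := od_bracket_comb (fun=> 0) (fun=> 0) 1 p q.
  by under eq_fun do rewrite mulr0 addr0; rewrite scale1r add0r => <-.
rewrite -[RHS]add0r -z0 -od_bracket_comb; congr od_bracket.
by apply/funext => K; rewrite add0r.
Qed.

Lemma od_bracketX s k l : od_bracket s 'X_k 'X_l = weighted N mon_mul s (gen_mon k) (gen_mon l).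
Proof. exact: biderivationX. Qed.

Lemma od_bracket_anti s p q : od_bracket s p q = - od_bracket s q p.
Proof. by apply: biderivation_anti => k l; exact: weighted_anti. Qed.

Lemma od_bracket_linear s q : linear ((od_bracket s)^~ q).
Proof. exact: biderivation_linear. Qed.

Lemma od_bracketM s p q r :
  od_bracket s p (q * r) = od_bracket s p q * r + q * od_bracket s p r.
Proof. exact: biderivationM. Qed.

Lemma od_bracketD s p q r : od_bracket s p (q + r) = od_bracket s p q + od_bracket s p r.
Proof.
rewrite !(od_bracket_anti s p) -[q]scale1r (od_bracket_linear s p 1 q r) !scale1r.
by rewrite opprD.
Qed.

Lemma od_bracketZr s p k q : od_bracket s p (k *: q) = k *: od_bracket s p q.
Proof.
rewrite /od_bracket /biderivation scaler_sumr; apply: eq_bigr => i _.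
rewrite scaler_sumr; apply: eq_bigr => j _.
by rewrite mderivZ -!mul_mpolyC; ring.
Qed.

(** The projection to degree 2 is linear, hence it commutes with the structure
    constants, and it fixes the products of two variables. *)
Lemma od_bracket_homog s : is_quadratic (od_bracket s).
Proof.
move=> k l; rewrite od_bracketX.
have E : pihomog mdeg 2 (weighted N mon_mul s (gen_mon k) (gen_mon l)) =
    weighted N mon_mul s (gen_mon k) (gen_mon l).
  rewrite (weighted_linear _ (pihomog mdeg 2)); apply: eq_weighted => p q.
  have h : mon_mul p q \is 2.-homog.
    by rewrite /mon_mul -mpolyXD dhomogX /= mdegD !mdeg1.
  exact: pihomog_dE.
by rewrite -E pihomogP.
Qed.

Let jacobiator_collect (t : C) (a1 a2 a3 b1 b2 b3 c1 c2 c3 d1 d2 d3 : {mpoly C[n]}) :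
  a1 + t *: b1 + t *: (c1 + t *: d1) + (a2 + t *: b2 + t *: (c2 + t *: d2))
  + (a3 + t *: b3 + t *: (c3 + t *: d3)) =
  a1 + a2 + a3 + t *: (b1 + c1 + (b2 + c2) + (b3 + c3)) + t ^+ 2 *: (d1 + d2 + d3).
Proof. by rewrite -!mul_mpolyC rmorphXn /=; ring. Qed.

(** After division by s Lab0 the curve has parameters a_i = s (Lab1 i) / s Lab0 and
    so on; the second condition is b_2^2 + 4 a_3 <> 0, the leading coefficient of
    the discriminant of its equation in g. *)
Definition od_generic (s : od_label -> C) : bool :=
  (s Lab0 != 0) && (s (Lab2 ord_max) ^+ 2 + 4 * s (Lab1 ord_max) * s Lab0 != 0).

(** The Jacobiator of three variables is quadratic in the weights, so along the line
    s + t e it is a polynomial in t.  For the direction e of Lab0 and a_3 all but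
    finitely many points of the line are generic. *)
Lemma od_bracket_dense :
  (forall s, od_generic s -> is_poisson (od_bracket s)) ->
  forall s, is_poisson (od_bracket s).
Proof.
move=> gen s.
apply: (poisson_generators (od_bracket_linear s) (od_bracket_anti s) (od_bracketM s)).
move=> i j k.
pose e K : C := match K with Lab0 => 1 | Lab1 r => (r == ord_max)%:R | _ => 0 end.
pose ob := od_bracket.
have [J1 [J2 JE]] : exists J1 J2 : {mpoly C[n]}, forall t,
    jacobiator (ob (fun K => s K + t * e K)) 'X_i 'X_j 'X_k =
    jacobiator (ob s) 'X_i 'X_j 'X_k + t *: J1 + t ^+ 2 *: J2.
  eexists; eexists => t.
  rewrite /jacobiator /ob !od_bracket_comb !od_bracketD !od_bracketZr.
  exact: jacobiator_collect.
move: (jacobiator _ _ _ _) JE => J JE.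
pose r : {poly C} := ('X + (s Lab0)%:P) * ((s (Lab2 ord_max))%:P ^+ 2
   + 4 * ('X + (s (Lab1 ord_max))%:P) * ('X + (s Lab0)%:P)).
have r0 : r != 0.
  have X0 x : 'X + x%:P != 0 :> {poly C} by rewrite -size_poly_eq0 size_XaddC.
  apply: mulf_neq0; first exact: X0.
  rewrite -size_poly_eq0 addrC -rmorphXn /= -mulrA -(polyC_natr _ 4).
  have sz : size ((4%:R%:P : {poly C}) * (('X + (s (Lab1 ord_max))%:P) * ('X + (s Lab0)%:P))) = 3%N.
    by rewrite size_Cmul ?pnatr_eq0 // size_mul // !size_XaddC.
  by rewrite size_polyDl sz // ltnS (leq_trans (size_polyC_leq1 _)).
apply/mpolyP => M; rewrite mcoeff0.
pose q : {poly C} := (J@_M)%:P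
  + (J1@_M) *: 'X + (J2@_M) *: 'X^2.
have q0 : q = 0.
  apply: (poly_vanish r0) => t; rewrite !hornerE /= => rt.
  have : od_generic (fun K => s K + t * e K).
    move: rt; rewrite mulf_eq0 negb_or => /andP[t0 t1]; rewrite /od_generic /=.
    rewrite ?eqxx !mulr1 mulr0 addr0 addrC t0 /=.
    by move: t1; congr (~~ (_ == _)); ring.
  move=> /gen[_ _ _ /(_ 'X_i 'X_j 'X_k)]; rewrite -/(jacobiator _ _ _ _) JE.
  move/(congr1 (mcoeff M)); rewrite !mcoeffD !mcoeffZ mcoeff0 => <-.
  ring.
move/(congr1 (fun p : {poly C} => p`_0)): q0.
by rewrite coef0 !coefD coefC !coefZ coefX coefXn !mulr0 !addr0.
Qed.
End Brackets.

(** * The Jacobi identity at three points *)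
Section CyclicIdentity.
Variables (R : comNzRingType) (P M : Type) (e0 e1 e2 : P -> M -> R).
Variables (K K' : P -> P -> R).

(** The bracket at the points p and q; e0, e1, e2 are the values of a function and
    of its first two derivatives along the flow of D. *)
Definition pair_form (p q : P) (j k : M) : R :=
  K p q * (e0 p j * e0 q k - e0 p k * e0 q j)
  + e0 p j * e1 q k + e0 q j * e1 p k - e0 p k * e1 q j - e0 q k * e1 p j.

(** The derivative of pair_form along the flow of D at q, K' being that of K. *)
Definition pair_form' (p q : P) (j k : M) : R :=
  K p q * (e0 p j * e1 q k - e0 p k * e1 q j)
  + K' p q * (e0 p j * e0 q k - e0 p k * e0 q j)
  + e0 p j * e2 q k + e1 q j * e1 p k - e0 p k * e2 q j - e1 q k * e1 p j.

(** The bracket of j and k is a function of two points.  One of them is kept at p,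
    and in the other the bracket with i is taken at the points q and r: by the
    Leibniz rule this is one of three summands of the double bracket. *)
Definition triple_form (p q r : P) (i j k : M) : R :=
  (K q r * e0 q i - e1 q i) * pair_form p r j k
  - (K q r * e0 r i + e1 r i) * pair_form p q j k
  + e0 q i * pair_form' p r j k + e0 r i * pair_form' p q j k.

Definition cyclic_form p q r i j k : R :=
  triple_form p q r i j k + triple_form q r p i j k + triple_form r p q i j k.

(** The last three conditions say that (D_1 + D_2) K_12 = h_1 - h_2 at each pair. *)
Lemma cyclic_form_eq0 (h : P -> R) (p q r : P) (i j k : M) :
  K q p = - K p q -> K r q = - K q r -> K p r = - K r p ->
  K' q p = K' p q - h p + h q -> K' r q = K' q r - h q + h r ->
  K' p r = K' r p - h r + h p ->
  cyclic_form p q r i j k + cyclic_form p q r j k i + cyclic_form p q r k i j = 0.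
Proof.
rewrite /cyclic_form /triple_form /pair_form /pair_form' => -> -> -> -> -> ->.
ring.
Qed.
End CyclicIdentity.

(** * Evaluation at points of the curve *)
Section Evaluation.
Variables (C : numClosedFieldType) (a : 'I_4 -> C) (b : 'I_3 -> C) (c : C).
Local Notation F := (Fod a b c).
Local Notation f := (f_od a b c).
Local Notation g := (g_od a b c).
Local Notation P := (Pod a).
Local Notation Q := (Qod b).

Definition od_point (p : C * C) : Prop :=
  (p.1 + c) * p.2 ^+ 2 = P.[p.1] + Q.[p.1] * p.2.

Definition eval_at (p : C * C) (x : F) : C^o :=
  (repr x).@[fun i => if i == 0 then p.1 else p.2].

Section Point.
Variable p : C * C.
Hypothesis onp : od_point p.
Local Notation ev := (eval_at p).

Let w (i : 'I_2) := if i == 0 then p.1 else p.2.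

Let horner_w (q : {poly C}) : (horner_alg 'X_0 q).@[w] = q.[p.1].
Proof.
elim/poly_ind: q => [|q k ih]; first by rewrite raddf0 meval0 horner0.
rewrite rmorphD rmorphM /= horner_algX horner_algC mevalD mevalM ih.
by rewrite alg_mpolyC mevalC mevalXU hornerMXaddC.
Qed.

Let rel_w : (rel_od a b c).@[w] = 0.
Proof.
rewrite /rel_od mevalB mevalM mevalD rmorphXn /= mevalD mevalM !horner_w.
by rewrite !mevalXU mevalC /w /= onp subrr.
Qed.

Lemma eval_pi q : ev (pi_od a b c q) = q.@[w].
Proof.
apply/eqP; rewrite /eval_at -subr_eq0 -mevalB.
have : repr (pi_od a b c q) - q \in ideal_od a b c.
  by rewrite -pi_od_eq0 rmorphB /= repr_odK subrr.
by move=> /gen_idealP[r ->]; rewrite big_ord1 /= mevalM rel_w mulr0.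
Qed.

Lemma eval_linear : linear ev.
Proof.
move=> k x y; rewrite -[x]repr_odK -[y]repr_odK -linearP !eval_pi.
by rewrite mevalD mevalZ.
Qed.

Lemma evalM x y : ev (x * y) = ev x * ev y.
Proof. by rewrite -[x]repr_odK -[y]repr_odK -rmorphM !eval_pi mevalM. Qed.

Lemma eval_alg k : ev k%:A = k.
Proof. by rewrite -pi_odC eval_pi mevalC. Qed.

Lemma eval_f : ev f = p.1.
Proof. by rewrite eval_pi mevalXU. Qed.

Lemma eval_g : ev g = p.2.
Proof. by rewrite eval_pi mevalXU. Qed.

Lemma eval_horner q : ev (horner_alg f q) = q.[p.1].
Proof. by rewrite -(lrmorph_horner_alg (pi_od a b c)) eval_pi horner_w. Qed.
End Point.

Lemma horner_alg_const (A : comAlgType C) (k : C) (q : {poly C}) :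
  horner_alg (k%:A : A) q = (q.[k])%:A.
Proof.
elim/poly_ind: q => [|q l ih]; first by rewrite raddf0 horner0 scale0r.
rewrite rmorphD rmorphM /= horner_algX horner_algC ih hornerMXaddC.
by rewrite scalerDl -scalerAl mul1r scalerA.
Qed.

Lemma od_generic_point : on_curve a b c f g.
Proof. exact: od_relation. Qed.

Lemma od_const_point p : od_point p -> on_curve a b c (p.1%:A : F) p.2%:A.
Proof.
move=> onp; rewrite /on_curve !horner_alg_const.
rewrite -[_%:A]/(in_alg F p.1) -[c%:A]/(in_alg F c) -[p.2%:A]/(in_alg F p.2).
rewrite -[(_.[p.1])%:A]/(in_alg F _) -[(_.[p.1])%:A]/(in_alg F Q.[p.1]).
by rewrite -rmorphD -rmorphXn -!rmorphM -rmorphD onp.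
Qed.

Lemma D_odX (x : F) k : D_od (x ^+ k) = k%:R * x ^+ k.-1 * D_od x.
Proof.
elim: k => [|k IH].
  rewrite expr0 !mul0r; apply: (addrI (D_od 1)).
  by rewrite addr0 -{3}[1]mulr1 D_odM mulr1 mul1r.
rewrite exprS D_odM IH; case: k {IH} => [|k] /=; first by ring.
by rewrite exprS; ring.
Qed.

Lemma D_od_mon x : D_od (mon_val f g x) = curve_der a b c f g x.
Proof.
rewrite /mon_val D_odM !D_odX D_od_f D_od_g /curve_der /mon_der.
rewrite /curve_df /curve_dg; case: x => [[] i] /=; ring.
Qed.
End Evaluation.

(** * The bracket at a pair of points *)
Section PointPairs.
Variables (C : numClosedFieldType) (a : 'I_4 -> C) (b : 'I_3 -> C) (c N : C).
Local Notation F := (Fod a b c).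
Local Notation f := (f_od a b c).
Local Notation g := (g_od a b c).
Local Notation P := (Pod a).
Local Notation Q := (Qod b).
Implicit Types p q : C * C.

Definition point_df p : C := 2 * (p.1 + c) * p.2 - Q.[p.1].
Definition point_dg p : C := P^`().[p.1] + Q^`().[p.1] * p.2 - p.2 ^+ 2.

Definition jet0 p x : C := mon_val p.1 p.2 x.
Definition jet1 p x : C := mon_der p.1 p.2 (point_df p) (point_dg p) x.
(** The second derivative of f^i g^d along D. *)
Definition jet2 p x : C := eval_at p (D_od (D_od (mon_val f g x))).

(** kernel_top is 2 (p.1 - q.1) K at (p, q).  The primes are derivatives along the
    flow of D at q, computed with D f = point_df and D g = point_dg. *)
Definition kernel_top p q : C :=
  N * (2 * ((p.1 + c) * p.2 + (q.1 + c) * q.2) - Q.[p.1] - Q.[q.1])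
  + (p.1 - q.1) * (2 * (q.2 - p.2) + b ord_max * (p.1 - q.1)).

Definition kernel_top' p q : C :=
  N * (2 * point_df q * q.2 + 2 * (q.1 + c) * point_dg q - Q^`().[q.1] * point_df q)
  - point_df q * (2 * (q.2 - p.2) + b ord_max * (p.1 - q.1))
  + (p.1 - q.1) * (2 * point_dg q - b ord_max * point_df q).

Definition kernel p q : C := kernel_top p q / (2 * (p.1 - q.1)).

Definition kernel' p q : C :=
  kernel_top' p q / (2 * (p.1 - q.1))
  + point_df q * kernel_top p q / (2 * (p.1 - q.1) ^+ 2).

(** The symmetric bilinear form of the quadratic form {x, y}, at the vectors with
    coordinates z and w. *)
Definition polarize (z w : mon -> C) (x y : mon) : C^o :=
  weighted N (fun s t => z s * w t + z t * w s : C^o) (od_weight 1 a b c) x y.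

Section Pair.
Variables p q : C * C.
Hypotheses (onp : od_point a b c p) (onq : od_point a b c q) (pq : p.1 != q.1).

Local Notation ev := (@eval_at C a b c q).

Let evM := evalM onq.
Let evD x y : ev (x + y) = ev x + ev y.
Proof. by have := eval_linear onq 1 x y; rewrite !scale1r. Qed.
Let ev0 : ev 0 = 0.
Proof. by apply: (addrI (ev 0)); rewrite -evD !addr0. Qed.
Let evN x : ev (- x) = - ev x.
Proof. by apply: (addrI (ev x)); rewrite -evD !subrr ev0. Qed.
Let ev_nat k : ev k%:R = k%:R.
Proof. by rewrite -(rmorph_nat (in_alg F)) [LHS](eval_alg onq). Qed.
Let ev1 : ev 1 = 1. Proof. exact: ev_nat 1%N. Qed.
Let evX x k : ev (x ^+ k) = ev x ^+ k.
Proof. by elim: k => [|k IH]; rewrite ?expr0 ?ev1 // !exprS evM IH. Qed.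

Let evE := (evD, evN, evM, evX, ev_nat, ev0, eval_f onq, eval_g onq, eval_alg onq,
            eval_horner onq).

Let p1 : F := p.1%:A.
Let p2 : F := p.2%:A.

Let on1 : on_curve a b c p1 p2 := od_const_point onp.
Let onf : on_curve a b c f g := od_generic_point a b c.

Lemma eval_mon x : ev (mon_val f g x) = jet0 q x.
Proof. by rewrite /mon_val !evE. Qed.

Lemma eval_der x : ev (curve_der a b c f g x) = jet1 q x.
Proof. by rewrite /curve_der /mon_der /curve_df /curve_dg !evE. Qed.

Lemma eval_mon_const x : ev (mon_val p1 p2 x) = jet0 p x.
Proof. by rewrite /mon_val !evE. Qed.

Lemma eval_der_const x : ev (curve_der a b c p1 p2 x) = jet1 p x.
Proof. by rewrite /curve_der /mon_der /curve_df /curve_dg !horner_alg_const !evE. Qed.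

Lemma eval_kernel : ev (kernel_num b c N p1 p2 f g) = kernel_top p q.
Proof. by rewrite /kernel_num !horner_alg_const /= !evE. Qed.

Let ev_form (t k x1 y1 x2 y2 x1' y1' x2' y2' : F) :
  ev (k * (x1 * y2 - y1 * x2)
      + 2 * t * (x1 * y2' + x2 * y1' - y1 * x2' - y2 * x1')) =
  ev k * (ev x1 * ev y2 - ev y1 * ev x2)
  + 2 * ev t * (ev x1 * ev y2' + ev x2 * ev y1' - ev y1 * ev x2' - ev y2 * ev x1').
Proof. by rewrite !evE. Qed.

Let ev_sym (x1 y1 x2 y2 : F) : ev (x1 * y2 + y1 * x2) = ev x1 * ev y2 + ev y1 * ev x2.
Proof. by rewrite !evE. Qed.

(** Evaluation at q of weighted_bracket_num for the constant point p and the
    generic point (f, g) of the curve. *)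
Lemma polarize_jet0 x y :
  polarize (jet0 p) (jet0 q) x y = pair_form jet0 jet1 kernel p q x y.
Proof.
pose L := HB.pack_for {linear F -> C^o} ev (GRing.isLinear.Build _ _ _ _ _ (eval_linear onq)).
have := congr1 ev (weighted_bracket_num N on1 onf x y).
rewrite /bracket_num ev_form eval_kernel !eval_mon !eval_mon_const.
rewrite !eval_der !eval_der_const evM evM ev_nat evD evN (eval_f onq) (eval_alg onq).
rewrite -[ev (weighted _ _ _ _ _)]/(L _) weighted_linear /=.
have -> : weighted N (fun s t => ev (sym_val p1 p2 f g s t)) (od_weight 1 a b c) x y =
    polarize (jet0 p) (jet0 q) x y.
  by apply: eq_weighted => s t; rewrite /sym_val ev_sym !eval_mon !eval_mon_const.
move=> E; have uv : p.1 - q.1 != 0 by rewrite subr_eq0.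
apply: (@mulfI _ (2 * (p.1 - q.1))); first by rewrite mulf_neq0 // pnatr_eq0.
rewrite E /pair_form /kernel; field.
by rewrite uv.
Qed.

Local Notation D := (@D_od C a b c).

Let DD x y : D (x + y) = D x + D y. Proof. exact: linearD. Qed.
Let DN x : D (- x) = - D x. Proof. exact: linearN. Qed.
Let DM : forall x y, D (x * y) = D x * y + x * D y. Proof. exact: D_odM. Qed.
Let D1 : D 1 = 0.
Proof. by apply: (addrI (D 1)); rewrite addr0 -{3}[1]mulr1 DM mulr1 mul1r. Qed.
Let DA k : D k%:A = 0. Proof. by rewrite linearZ /= D1 scaler0. Qed.
Let Dn k : D k%:R = 0. Proof. by rewrite -(rmorph_nat (in_alg F)); exact: DA. Qed.
Let DX : forall x k, D (x ^+ k) = k%:R * x ^+ k.-1 * D x. Proof. exact: D_odX. Qed.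
Let D_horner (r : {poly C}) : D (horner_alg f r) = horner_alg f r^`() * D f.
Proof.
elim/poly_ind: r => [|r k ih]; first by rewrite deriv0 !raddf0 mul0r.
rewrite derivMXaddC !rmorphD !rmorphM /= horner_algX horner_algC DD DM DA ih; ring.
Qed.

Let D_const x : D (mon_val p1 p2 x) = 0.
Proof. by rewrite /mon_val DM !DX !DA !mulr0 mul0r addr0. Qed.

Let D_const' x : D (curve_der a b c p1 p2 x) = 0.
Proof.
rewrite /curve_der /mon_der /curve_df /curve_dg !horner_alg_const.
by rewrite !(DD, DN, DM, DX, DA, Dn, mulr0, mul0r, addr0, oppr0).
Qed.

Let D_form (t k x1 y1 x2 y2 x1' y1' x2' y2' : F) :
  D x1 = 0 -> D y1 = 0 -> D x1' = 0 -> D y1' = 0 ->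
  D (k * (x1 * y2 - y1 * x2)
      + 2 * t * (x1 * y2' + x2 * y1' - y1 * x2' - y2 * x1')) =
  (D k * (x1 * y2 - y1 * x2)
    + 2 * D t * (x1 * y2' + x2 * y1' - y1 * x2' - y2 * x1')) +
  (k * (x1 * D y2 - y1 * D x2)
    + 2 * t * (x1 * D y2' + D x2 * y1' - y1 * D x2' - D y2 * x1')).
Proof.
by move=> e1 e2 e3 e4; rewrite !(DD, DN, DM, Dn) e1 e2 e3 e4; ring.
Qed.

Let eval_Df : ev (D f) = point_df q.
Proof. by rewrite D_od_f !evE. Qed.

Let eval_Dg : ev (D g) = point_dg q.
Proof. by rewrite D_od_g !evE. Qed.

Let eval_D_kernel : ev (D (kernel_num b c N p1 p2 f g)) = kernel_top' p q.
Proof.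
rewrite /kernel_num !horner_alg_const.
rewrite !(DD, DN, DM, DA, Dn) D_horner /= !evE eval_Df eval_Dg.
rewrite /kernel_top'; ring.
Qed.

Let D_sym (x1 y1 x2 y2 : F) : D x1 = 0 -> D y1 = 0 ->
  D (x1 * y2 + y1 * x2) = x1 * D y2 + y1 * D x2.
Proof. by move=> e1 e2; rewrite DD !DM e1 e2 !mul0r !add0r. Qed.

Let lhsE T : ev (D (2 * (p1 - f) * T)) =
  2 * ev (- D f) * ev T + 2 * ev (p1 - f) * ev (D T).
Proof. by rewrite !(DD, DN, DM, DA, Dn) !evE; ring. Qed.

(** The same identity with D applied before the evaluation. *)
Lemma polarize_jet1 x y :
  polarize (jet0 p) (jet1 q) x y = pair_form' jet0 jet1 jet2 kernel kernel' p q x y.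
Proof.
pose L := HB.pack_for {linear F -> C^o} ev (GRing.isLinear.Build _ _ _ _ _ (eval_linear onq)).
have := congr1 (fun z => ev (D z)) (weighted_bracket_num N on1 onf x y).
rewrite /bracket_num D_form ?D_const ?D_const' // -!D_od_mon.
rewrite evD !ev_form eval_kernel eval_D_kernel lhsE.
rewrite -[ev (weighted _ _ _ _ _)]/(L _) -[ev (D (weighted _ _ _ _ _))]/(L (D _)).
rewrite (weighted_linear N (@D_od C a b c)) !weighted_linear.
have -> : weighted N (fun s t => L (sym_val p1 p2 f g s t)) (od_weight 1 a b c) x y =
    polarize (jet0 p) (jet0 q) x y.
  by apply: eq_weighted => s t; rewrite /= /sym_val ev_sym !eval_mon !eval_mon_const.
have -> : weighted N (fun s t => L (D (sym_val p1 p2 f g s t))) (od_weight 1 a b c) x y =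
    polarize (jet0 p) (jet1 q) x y.
  apply: eq_weighted => s t; rewrite /= /sym_val D_sym ?D_const //.
  by rewrite ev_sym !D_od_mon !eval_der !eval_mon_const.
rewrite polarize_jet0 evN eval_Df evD evN eval_f // eval_alg // !D_od_mon.
rewrite !eval_mon !eval_mon_const !eval_der !eval_der_const -!D_od_mon.
rewrite -[ev (D (D (mon_val f g x)))]/(jet2 q x) -[ev (D (D (mon_val f g y)))]/(jet2 q y).
move=> E; have uv : p.1 - q.1 != 0 by rewrite subr_eq0.
apply: (@mulfI _ (2 * (p.1 - q.1))); first by rewrite mulf_neq0 // pnatr_eq0.
move/(canRL (addKr _)): E => ->.
rewrite DD DA DN add0r evN eval_Df.
rewrite /pair_form' /pair_form /kernel /kernel'; field.
by rewrite uv.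
Qed.
End Pair.

End PointPairs.

(** * The flow of the kernel *)
Section KernelFlow.
Variables (C : numClosedFieldType) (a : 'I_4 -> C) (b : 'I_3 -> C) (c N : C).
Local Notation P := (Pod a).
Local Notation Q := (Qod b).
Local Notation kernel_top := (kernel_top b c N).
Local Notation kernel := (kernel b c N).
Local Notation kernel' := (kernel' a b c N).
Local Notation point_df := (point_df b c).
Local Notation point_dg := (point_dg a b).
Implicit Types p q : C * C.

Lemma kernel_anti p q : kernel q p = - kernel p q.
Proof.
rewrite /kernel (_ : kernel_top q p = kernel_top p q); last by rewrite /kernel_top; ring.
by rewrite -[q.1 - p.1]opprB mulrN invrN mulrN.
Qed.

(** The function h with (D_1 + D_2) K_12 = h_1 - h_2: the first two lines come from the
    coefficients r_3, r_4 of R as N (r_3 f + 2 r_4 f^2), the rest from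
    g_2 - g_1 + b_2/2 (f_1 - f_2). *)
Definition kernel_defect p : C :=
  N * ((a (inord 2) + c * a (inord 3) + b (inord 1) * b (inord 2) / 2) * p.1
       + (2 * a (inord 3) + b (inord 2) ^+ 2 / 2) * p.1 ^+ 2)
  - point_dg p + b (inord 2) / 2 * point_df p.

Let horner_P t : P.[t] =
  a (inord 0) + a (inord 1) * t + a (inord 2) * t ^+ 2 + a (inord 3) * t ^+ 3.
Proof.
rewrite /Pod horner_sum !big_ord_recr big_ord0 /= add0r !hornerZ !hornerXn.
rewrite expr0 expr1 mulr1.
by congr (a _ + a _ * _ + a _ * _ + a _ * _); apply: val_inj; rewrite /= inordK.
Qed.

Let horner_Q t : Q.[t] = b (inord 0) + b (inord 1) * t + b (inord 2) * t ^+ 2.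
Proof.
rewrite /Qod horner_sum !big_ord_recr big_ord0 /= add0r !hornerZ !hornerXn.
rewrite expr0 expr1 mulr1.
by congr (b _ + b _ * _ + b _ * _); apply: val_inj; rewrite /= inordK.
Qed.

Let horner_P' t :
  P^`().[t] = a (inord 1) + a (inord 2) * (2 * t) + a (inord 3) * (3 * t ^+ 2).
Proof.
rewrite /Pod raddf_sum horner_sum !big_ord_recr big_ord0 /= add0r.
rewrite !derivZ !derivXn !hornerZ !hornerMn !hornerXn /= mulr0n mulr0 add0r.
rewrite expr0 expr1 mulr1 -[_ *+ 2]mulr_natl -[_ *+ 3]mulr_natl.
by congr (a _ + a _ * _ + a _ * _); apply: val_inj; rewrite /= inordK.
Qed.

Let horner_Q' t : Q^`().[t] = b (inord 1) + b (inord 2) * (2 * t).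
Proof.
rewrite /Qod raddf_sum horner_sum !big_ord_recr big_ord0 /= add0r.
rewrite !derivZ !derivXn !hornerZ !hornerMn !hornerXn /= mulr0n mulr0 add0r.
rewrite expr0 expr1 mulr1.
by congr (b _ + b _ * _); [apply: val_inj; rewrite /= inordK..|rewrite mulr_natl].
Qed.

(** R = (f + c) P + Q^2/4, the polynomial with y^2 = R(f) on the curve for
    y = (f + c) g - Q/2; branch_poly' is its derivative. *)
Definition branch_poly t : C := (t + c) * P.[t] + Q.[t] ^+ 2 / 4.

Definition branch_poly' t : C := P.[t] + (t + c) * P^`().[t] + Q.[t] * Q^`().[t] / 2.

Let b2E : ord_max = inord 2 :> 'I_3.
Proof. by apply: val_inj; rewrite /= inordK. Qed.

(** In terms of y, where point_df = 2 y.  On the curve D y = R'(f) and y^2 = R(f);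
    both hold modulo the relation, a multiple of which is subtracted first. *)
Let kernelE' p q : od_point a b c q -> p.1 != q.1 ->
  kernel' p q = N * branch_poly' q.1 / (p.1 - q.1)
    + 2 * N * (point_df p * point_df q / 4 + branch_poly q.1) / (p.1 - q.1) ^+ 2
    + point_dg q - b (inord 2) / 2 * point_df q.
Proof.
case: p q => [u G] [v H]; rewrite /od_point /= => onq uv.
pose Rq := (v + c) * H ^+ 2 - P.[v] - Q.[v] * H.
have Rq0 : Rq = 0 by rewrite /Rq onq; ring.
have -> : kernel' (u, G) (v, H) = kernel' (u, G) (v, H)
   - (N / (u - v) + 2 * N * (v + c) / (u - v) ^+ 2) * Rq by rewrite Rq0; ring.
have uv0 : u - v != 0 by rewrite subr_eq0.
rewrite /kernel' /kernel_top' /kernel_top /point_df /point_dg /Rq /= b2E.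
rewrite /branch_poly /branch_poly'; field.
by rewrite uv0.
Qed.

(** For a polynomial R of degree at most 4 with coefficients r_3, r_4 the expression
    (R'(u) + R'(v)) (u - v) - 2 (R(u) - R(v)) is (u - v)^3 (r_3 + 2 r_4 (u + v)). *)
Lemma branch_poly_sum u v : branch_poly u = branch_poly v
  + (u - v) * (branch_poly' u + branch_poly' v) / 2
  - (u - v) ^+ 3 / 2 * (a (inord 2) + c * a (inord 3) + b (inord 1) * b (inord 2) / 2
     + (2 * a (inord 3) + b (inord 2) ^+ 2 / 2) * (u + v)).
Proof.
rewrite /branch_poly /branch_poly' !horner_P !horner_Q !horner_P' !horner_Q'.
by field.
Qed.

Lemma kernel_flow p q : od_point a b c p -> od_point a b c q -> p.1 != q.1 ->
  kernel' q p = kernel' p q - kernel_defect p + kernel_defect q.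
Proof.
move=> onp onq pq; have qp : q.1 != p.1 by rewrite eq_sym.
rewrite (kernelE' onp qp) (kernelE' onq pq) /kernel_defect (branch_poly_sum p.1 q.1).
have pq0 : p.1 - q.1 != 0 by rewrite subr_eq0.
have qp0 : q.1 - p.1 != 0 by rewrite subr_eq0.
by field; rewrite pq0 qp0.
Qed.
End KernelFlow.

(** * Directional derivatives *)
Lemma mdeg_neq0 (n : nat) (M : 'X_{1..n}) : mdeg M != 0%N -> exists i, M i != 0%N.
Proof.
move=> M_neq0; apply/existsP; rewrite -negb_forall; apply/negP => /forallP M0.
by move/eqP: M_neq0; apply; rewrite mdegE big1 // => i _; exact/eqP/M0.
Qed.

Section Directional.
Variables (C : numClosedFieldType) (n : nat).
Implicit Types (p q : {mpoly C[n]}) (x y : 'I_n -> C).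

(** Three directional derivatives polarize a cubic form. *)
Definition dird x p : {mpoly C[n]} := \sum_l x l *: p^`M(l).

Lemma dirdD x p q : dird x (p + q) = dird x p + dird x q.
Proof.
by rewrite -big_split; apply: eq_bigr => l _; rewrite mderivD scalerDr.
Qed.

Lemma dirdZ x k p : dird x (k *: p) = k *: dird x p.
Proof.
rewrite scaler_sumr; apply: eq_bigr => l _.
by rewrite mderivZ !scalerA mulrC.
Qed.

Lemma dird_is_linear x : linear (dird x).
Proof. by move=> k p q; rewrite dirdD dirdZ. Qed.
HB.instance Definition _ x :=
  GRing.isLinear.Build C {mpoly C[n]} {mpoly C[n]} _ (dird x) (dird_is_linear x).

Lemma dirdM x p q : dird x (p * q) = dird x p * q + p * dird x q.
Proof.
rewrite mulr_suml mulr_sumr -big_split; apply: eq_bigr => l _.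
by rewrite mderivM scalerDr scalerAl scalerAr.
Qed.

Lemma dirdX x k : dird x 'X_k = (x k)%:MP.
Proof.
rewrite /dird (bigD1 k) //= mderivU eqxx big1 ?addr0 => [|l lk].
  by rewrite -mul_mpolyC mulr1.
by rewrite mderivU (negPf lk) scaler0.
Qed.

Lemma dirdC x k : dird x k%:MP = 0.
Proof. by rewrite /dird big1 // => l _; rewrite mderivC scaler0. Qed.

Lemma dird_comm x y p : dird x (dird y p) = dird y (dird x p).
Proof.
have E z w : dird z (dird w p) = \sum_k \sum_l (w k * z l) *: p^`M(k)^`M(l).
  rewrite /dird exchange_big /=; apply: eq_bigr => l _.
  rewrite (raddf_sum (mderiv l)) scaler_sumr; apply: eq_bigr => k _.
  by rewrite /= mderivZ scalerA mulrC.
rewrite !E exchange_big; apply: eq_bigr => k _; apply: eq_bigr => l _.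
by rewrite mderiv_comm mulrC.
Qed.

Lemma mderiv_homog d p i : p \is d.+1.-homog -> p^`M(i) \is d.-homog.
Proof.
move=> hp; apply/dhomogP => m; rewrite mcoeff_msupp mcoeff_mderiv => nz.
have : p@_(m + U_(i)) != 0 by apply: contra nz => /eqP ->; rewrite mul0rn.
move/dhomogP: hp => hp; rewrite -mcoeff_msupp => /hp.
by rewrite /= mdegD mdeg1 addn1 => -[].
Qed.

Lemma dird_homog d x p : p \is d.+1.-homog -> dird x p \is d.-homog.
Proof.
by move=> hp; apply: rpred_sum => l _; rewrite rpredZ // mderiv_homog.
Qed.

Lemma homog_mderiv_eq0 d p :
  p \is d.+1.-homog -> (forall i, p^`M(i) = 0) -> p = 0.
Proof.
move=> hp dp; apply/mpolyP => M; rewrite mcoeff0.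
have [dM|dM] := eqVneq (mdeg M) d.+1; last exact: (dhomog_nemf_coeff hp).
have [i Mi] : exists i, M i != 0%N by apply: mdeg_neq0; rewrite dM.
have := congr1 (mcoeff (M - U_(i))) (dp i); rewrite mcoeff_mderiv mcoeff0 submK.
  by move/eqP; rewrite mulrn_eq0 /= => /eqP.
apply/mnm_lepP => l; rewrite mnm1E; case: eqP => // <-.
by rewrite lt0n.
Qed.
End Directional.

(** * The points of the curve span *)
Section Span.
Variables (C : numClosedFieldType) (m : nat).
Local Notation n := m.*2.+1.

(** The sums are polynomials in t with the coefficients l k. *)
Lemma gen_mon_coef_eq0 (l : 'I_n -> C) (r : {poly C}) : r != 0 ->
  (forall t, r.[t] != 0 -> forall d,
     \sum_k (l k *+ ((gen_mon k).1 == d)) * t ^+ (gen_mon k).2 = 0) ->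
  forall k, l k = 0.
Proof.
move=> r0 H.
pose A d : {poly C} := \sum_k (l k *+ ((gen_mon k).1 == d)) *: 'X^((gen_mon k).2).
have A0 d : A d = 0.
  apply: (poly_vanish r0) => t /H/(_ d) Ht; rewrite -[RHS]Ht horner_sum.
  by apply: eq_bigr => k _; rewrite hornerZ hornerXn.
move=> k; have := congr1 (fun p : {poly C} => p`_(gen_mon k).2) (A0 (gen_mon k).1).
rewrite coef0 coef_sum (bigD1 k) //= big1 => [|j jk].
  by rewrite coefZ coefXn !eqxx mulr1n mulr1 addr0.
rewrite coefZ coefXn; case: eqP => [e1|]; last by rewrite mul0r.
case: eqP => [e2|]; last by rewrite mulr0.
case/eqP: jk; rewrite -[j]gen_monK -[k]gen_monK; congr mon_ord.
by rewrite [gen_mon j]surjective_pairing [gen_mon k]surjective_pairing e1 -e2.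
Qed.

Variables (a : 'I_4 -> C) (b : 'I_3 -> C) (c : C).
Local Notation P := (Pod a).
Local Notation Q := (Qod b).

Definition g_discriminant : {poly C} := Q ^+ 2 + 4 * ('X + c%:P) * P.

(** Its coefficient of degree 4 is the one assumed nonzero. *)
Lemma g_discriminant_neq0 : b ord_max ^+ 2 + 4 * a ord_max != 0 -> g_discriminant != 0.
Proof.
apply: contra => /eqP E.
have PE : P = (a (inord 0))%:P + (a (inord 1))%:P * 'X + (a (inord 2))%:P * 'X^2
    + (a ord_max)%:P * 'X^3.
  rewrite /Pod !big_ord_recr big_ord0 /= add0r -!mul_polyC expr0 mulr1 expr1.
  by congr ((a _)%:P + (a _)%:P * _ + (a _)%:P * _ + (a _)%:P * _);
    apply: val_inj; rewrite /= ?inordK.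
have QE : Q = (b (inord 0))%:P + (b (inord 1))%:P * 'X + (b ord_max)%:P * 'X^2.
  rewrite /Qod !big_ord_recr big_ord0 /= add0r -!mul_polyC expr0 mulr1 expr1.
  by congr ((b _)%:P + (b _)%:P * _ + (b _)%:P * _);
    apply: val_inj; rewrite /= ?inordK.
have dE : g_discriminant = (b ord_max ^+ 2 + 4 * a ord_max)%:P * 'X^4
    + (2 * b (inord 1) * b ord_max + 4 * (a (inord 2) + c * a ord_max))%:P * 'X^3
    + (b (inord 1) ^+ 2 + 2 * b (inord 0) * b ord_max
       + 4 * (a (inord 1) + c * a (inord 2)))%:P * 'X^2
    + (2 * b (inord 0) * b (inord 1) + 4 * (a (inord 0) + c * a (inord 1)))%:P * 'X
    + (b (inord 0) ^+ 2 + 4 * c * a (inord 0))%:P.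
  by rewrite /g_discriminant PE QE; ring.
have := congr1 (fun p : {poly C} => p`_4) dE.
by rewrite E coef0 !coefD !coefCM !coefXn coefX coefC /= !mulr0 !addr0 mulr1 => <-.
Qed.

(** Over almost every t there are two points with distinct g.  The vanishing of
    A(t) + A'(t) g at both gives A(t) = A'(t) = 0. *)
Lemma points_span (l : 'I_n -> C) (S : seq C) :
  b ord_max ^+ 2 + 4 * a ord_max != 0 ->
  (forall p, od_point a b c p -> p.1 \notin S ->
     \sum_k l k * jet0 p (gen_mon k) = 0) ->
  forall k, l k = 0.
Proof.
move=> /g_discriminant_neq0 d0 H.
pose r : {poly C} := ('X + c%:P) * g_discriminant * \prod_(s <- S) ('X - s%:P).
have r0 : r != 0.
  rewrite !mulf_neq0 //; first by rewrite -size_poly_eq0 size_XaddC.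
  by rewrite prodf_seq_neq0; apply/allP => s _; rewrite /= polyXsubC_eq0.
apply: (gen_mon_coef_eq0 r0) => t.
rewrite !hornerM hornerD hornerX hornerC !mulf_eq0 !negb_or horner_prod.
rewrite prodf_seq_neq0 => /andP[/andP[tc dt] /allP tS].
have tnS : t \notin S.
  by apply/negP => /tS; rewrite /= hornerXsubC subrr eqxx.
pose w := sqrtC g_discriminant.[t].
have wE : w ^+ 2 = Q.[t] ^+ 2 + 4 * (t + c) * P.[t].
  by rewrite sqrtCK /g_discriminant !hornerE /=; ring.
have w0 : w != 0 by rewrite sqrtC_eq0.
pose root e := (Q.[t] + e * w) / (2 * (t + c)).
have on e : e ^+ 2 = 1 -> od_point a b c (t, root e).
  move=> e2; rewrite /od_point /root /=.
  have -> : P.[t] = (w ^+ 2 - Q.[t] ^+ 2) / (4 * (t + c)) by rewrite wE; field.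
  have -> : w ^+ 2 = (e * w) ^+ 2 by rewrite exprMn e2 mul1r.
  by field.
pose A d := \sum_k (l k *+ ((gen_mon k).1 == d)) * t ^+ (gen_mon k).2.
have AE e : e ^+ 2 = 1 -> A false + A true * root e = 0.
  move=> e2; rewrite -[RHS](H _ (on e e2) tnS) mulr_suml -big_split /=.
  apply: eq_bigr => k _; rewrite /jet0 /mon_val /=.
  by case: (gen_mon k).1; rewrite /= ?mulr0n ?mulr1n ?expr1 ?expr0; ring.
have A1 : A true = 0.
  have E1 := AE 1 (expr1n _ _).
  have E2 : A false + A true * root (-1) = 0 by apply: AE; rewrite sqrrN expr1n.
  have : A true * (root 1 - root (-1)) = 0 by rewrite -[RHS](subrr 0) -{1}E1 -E2; ring.
  rewrite (_ : root 1 - root (-1) = w / (t + c)); last by rewrite /root; field.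
  by move/eqP; rewrite !mulf_eq0 invr_eq0 (negPf w0) (negPf tc) !orbF => /eqP.
have A2 : A false = 0 by rewrite -[RHS](AE 1 (expr1n _ _)) A1 mul0r addr0.
by case.
Qed.

(** The set S leaves room to avoid the first coordinates of earlier points. *)
Lemma points_dird_eq0 d (q : {mpoly C[n]}) (S : seq C) :
  b ord_max ^+ 2 + 4 * a ord_max != 0 -> q \is d.+1.-homog ->
  (forall p, od_point a b c p -> p.1 \notin S ->
     dird (fun k : 'I_n => jet0 p (gen_mon k)) q = 0) -> q = 0.
Proof.
move=> h hq H; apply: (homog_mderiv_eq0 hq) => i; apply/mpolyP => M.
rewrite mcoeff0; apply: (points_span (l := fun i => q^`M(i)@_M) (S := S) h) => p onp pS.
have := congr1 (mcoeff M) (H p onp pS); rewrite mcoeff0 raddf_sum => E.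
by rewrite -[RHS]E; apply: eq_bigr => k _; rewrite /= mcoeffZ mulrC.
Qed.
End Span.

(** * The Jacobi identity *)
Section Polarize.
Variables (C : numClosedFieldType) (a : 'I_4 -> C) (b : 'I_3 -> C) (c N : C).
Implicit Types z w : mon -> C.
Local Notation polarize := (polarize a b c N).

Lemma polarizeC z w x y : polarize z w x y = polarize w z x y.
Proof.
by apply: eq_weighted => s t; rewrite addrC [z t * _]mulrC [w t * _]mulrC.
Qed.

Lemma polarize_comb k z z' w x y :
  polarize (fun s => k * z s + z' s) w x y =
  k * polarize z w x y + polarize z' w x y.
Proof.
pose L (v : (C^o * C^o)%type) : C^o := k * v.1 + v.2.
have Ll : linear L.
  by move=> l u v; rewrite /L /= /GRing.scale /=; ring.
pose LL := HB.pack_for {linear (C^o * C^o)%type -> C^o} L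
  (GRing.isLinear.Build _ _ _ _ _ Ll).
pose mu z s t : C^o := z s * w t + z t * w s.
pose two s t : C^o * C^o := (mu z s t, mu z' s t).
pose W := weighted N two (od_weight 1 a b c) x y.
have fstE : polarize z w x y = W.1 by rewrite /W (weighted_linear N fst).
have sndE : polarize z' w x y = W.2 by rewrite /W (weighted_linear N snd).
rewrite fstE sndE -[RHS]/(LL W) weighted_linear; apply: eq_weighted => s t.
by rewrite /= /L /two /mu /=; ring.
Qed.
End Polarize.

Section Jacobi.
Variables (C : numClosedFieldType) (m : nat).
Variables (a : 'I_4 -> C) (b : 'I_3 -> C) (c : C).
Local Notation n := m.*2.+1.
Local Notation N := (n%:R : C).
Local Notation ob := (@od_bracket C m (od_weight 1 a b c)).
Implicit Types (x y z : 'I_n -> C) (i j k l : 'I_n).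

Definition polar j k x y : C :=
  polarize a b c N (fun s => x (mon_ord m s)) (fun s => y (mon_ord m s))
    (gen_mon j) (gen_mon k).

Let dird2 x y j k : dird x (dird y (ob 'X_j 'X_k)) = (polar j k x y)%:MP.
Proof.
pose M (k : C^o) : {mpoly C[n]} := (k : C)%:MP.
have Ml : linear M.
  by move=> t u v; rewrite /M mpolyCD -mul_mpolyC -mpolyCM.
pose ML := HB.pack_for {linear C^o -> {mpoly C[n]}} M
  (GRing.isLinear.Build _ _ _ _ _ Ml).
rewrite od_bracketX (weighted_linear N (dird y)) (weighted_linear N (dird x)).
rewrite -[RHS]/(ML _) weighted_linear; apply: eq_weighted => s t.
rewrite /= /M /mon_mul !(dirdM, dirdX, dirdD, dirdC) mul0r add0r mulr0 addr0.
by rewrite mpolyCD !mpolyCM; ring.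
Qed.

Let dird3 x y z j k : dird x (dird y (dird z (ob 'X_j 'X_k))) = 0.
Proof. by rewrite dird2 dirdC. Qed.

Let mderivE l (p : {mpoly C[n]}) : p^`M(l) = dird (fun k => (k == l)%:R) p.
Proof.
rewrite /dird (bigD1 l) //= eqxx scale1r big1 ?addr0 // => k kl.
by rewrite (negPf kl) scale0r.
Qed.

Let obX i p : ob 'X_i p = \sum_l p^`M(l) * ob 'X_i 'X_l.
Proof.
rewrite {1}/od_bracket /biderivation (bigD1 i) //= [X in _ + X]big1 ?addr0 => [|k ki].
  by apply: eq_bigr => l _; rewrite mderivU eqxx mul1r od_bracketX.
by rewrite big1 // => l _; rewrite mderivU (negPf ki) !mul0r.
Qed.

Let contract x (v : 'I_n -> C) (p : {mpoly C[n]}) :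
  \sum_l dird x p^`M(l) * (v l)%:MP = dird v (dird x p).
Proof.
rewrite dird_comm linear_sum; apply: eq_bigr => l _.
by rewrite linearZ /= -mul_mpolyC mulrC.
Qed.

Let mderiv2 x y j k l : dird x (dird y (ob 'X_j 'X_k)^`M(l)) = 0.
Proof. by rewrite mderivE (dird_comm y) (dird_comm x) dird2 dirdC. Qed.

Let leibniz3 x y z (p q : {mpoly C[n]}) :
  dird x (dird y p) = 0 -> dird x (dird z p) = 0 -> dird y (dird z p) = 0 ->
  dird x (dird y (dird z q)) = 0 ->
  dird x (dird y (dird z (p * q))) = dird x p * dird y (dird z q)
    + dird y p * dird x (dird z q) + dird z p * dird x (dird y q).
Proof.
move=> xy xz yz xyz.
rewrite dirdM !dirdD !dirdM yz !dirdD !dirdM xy xz xyz linear0; ring.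
Qed.

(** By the Leibniz rule exactly one derivative must fall on the partial derivative
    of {x_j, x_k}, a linear form, and two on {x_i, x_l}; the sum over l then
    contracts the inner bracket into a direction of differentiation. *)
Lemma dird_jacobi x y z i j k :
  dird x (dird y (dird z (ob 'X_i (ob 'X_j 'X_k)))) =
  (polar j k (fun l => polar i l y z) x + polar j k (fun l => polar i l x z) y
   + polar j k (fun l => polar i l x y) z)%:MP.
Proof.
rewrite obX 2!mpolyCD -!dird2 -!(contract _ (fun l => polar i l _ _)) -!big_split /=.
rewrite (linear_sum (dird z)) (linear_sum (dird y)) (linear_sum (dird x)).
apply: eq_bigr => l _ /=.
by rewrite leibniz3 ?mderiv2 ?dird3 // !dird2.
Qed.

Lemma od_bracket_homog3 i (p : {mpoly C[n]}) :
  p \is 2.-homog -> ob 'X_i p \is 3.-homog.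
Proof.
move=> hp; rewrite obX; apply: rpred_sum => l _.
exact: (dhomogM (mderiv_homog l hp) (od_bracket_homog _ i l)).
Qed.

Local Notation point p := (fun k : 'I_n => jet0 p (gen_mon k)).
Local Notation form := (pair_form (@jet0 C) (jet1 a b c) (kernel b c N)).
Let polarE i j (z w z' w' : mon -> C) :
  (forall s, in_range m s -> z s = z' s) -> (forall s, in_range m s -> w s = w' s) ->
  polarize a b c N z w (gen_mon i) (gen_mon j) =
  polarize a b c N z' w' (gen_mon i) (gen_mon j).
Proof.
move=> zz ww; apply: eq_weighted_in; rewrite ?gen_mon_range //.
- by move=> s t; rewrite addrC.
- by move=> s t; rewrite addrC.
- by move=> s t hs ht; rewrite !zz ?ww.
Qed.

Let polar_point p q i j : od_point a b c p -> od_point a b c q -> p.1 != q.1 ->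
  polar i j (point p) (point q) = form p q (gen_mon i) (gen_mon j).
Proof.
move=> onp onq pq; rewrite -(polarize_jet0 N onp onq pq).
by apply: polarE => s hs; rewrite mon_ordK.
Qed.

Let polar_triple p q r i j k : od_point a b c p -> od_point a b c q ->
  od_point a b c r -> p.1 != q.1 -> p.1 != r.1 -> q.1 != r.1 ->
  polar j k (fun l => polar i l (point q) (point r)) (point p) =
  triple_form (@jet0 C) (jet1 a b c) (@jet2 C a b c) (kernel b c N) (kernel' a b c N)
    p q r (gen_mon i) (gen_mon j) (gen_mon k).
Proof.
move=> onp onq onr pq pr qr; set I := gen_mon i.
pose kqr := kernel b c N q r.
pose v s : C := (kqr * jet0 q I - jet1 a b c q I) * jet0 r s
  + (- (kqr * jet0 r I + jet1 a b c r I) * jet0 q s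
  + (jet0 q I * jet1 a b c r s + (jet0 r I * jet1 a b c q s + 0))).
transitivity (polarize a b c N v (jet0 p) (gen_mon j) (gen_mon k)).
  apply: polarE => s hs; last by rewrite mon_ordK.
  by rewrite polar_point // mon_ordK // /pair_form /v /kqr; ring.
rewrite /v !polarize_comb.
rewrite (_ : polarize _ _ _ _ (fun=> 0) _ _ _ = 0); last first.
  apply: (addrI (polarize a b c N (fun=> 0) (jet0 p) (gen_mon j) (gen_mon k))).
  rewrite addr0 -[X in X + _]mul1r -polarize_comb.
  by apply: eq_weighted => s t; rewrite mulr0 addr0.
rewrite ![polarize _ _ _ _ _ (jet0 p) _ _]polarizeC !polarize_jet0 // !polarize_jet1 //.
rewrite /triple_form -/kqr -/I; ring.
Qed.

(** The three summands of dird_jacobi are the three cyclic triple forms. *)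
Lemma jacobi_points p q r i j k : od_point a b c p -> od_point a b c q ->
  od_point a b c r -> p.1 != q.1 -> p.1 != r.1 -> q.1 != r.1 ->
  dird (point p) (dird (point q) (dird (point r) (jacobiator ob 'X_i 'X_j 'X_k))) = 0.
Proof.
move=> onp onq onr pq pr qr.
have qp : q.1 != p.1 by rewrite eq_sym.
have rp : r.1 != p.1 by rewrite eq_sym.
have rq : r.1 != q.1 by rewrite eq_sym.
have polarC i' l x y : polar i' l x y = polar i' l y x by exact: polarizeC.
have cyc i' j' k' : dird (point p) (dird (point q) (dird (point r)
    (ob 'X_i' (ob 'X_j' 'X_k')))) =
    (cyclic_form (@jet0 C) (jet1 a b c) (@jet2 C a b c) (kernel b c N) (kernel' a b c N)
    p q r (gen_mon i') (gen_mon j') (gen_mon k'))%:MP.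
  rewrite dird_jacobi; congr (_ %:MP).
  have -> : (fun l => polar i' l (point p) (point r)) =
      (fun l => polar i' l (point r) (point p)) by apply/funext => l; exact: polarC.
  by rewrite !polar_triple // /cyclic_form; ring.
rewrite /jacobiator 2!(dirdD (point r)) 2!(dirdD (point q)) 2!(dirdD (point p)).
apply: etrans (congr2 _ (congr2 _ (cyc i j k) (cyc j k i)) (cyc k i j)) _.
rewrite -2!mpolyCD (@cyclic_form_eq0 _ _ _ _ _ _ _ _ (kernel_defect a b c N)) //.
1-3: exact: kernel_anti.
1-3: exact: kernel_flow.
Qed.

Lemma od_bracket_jacobi i j k : b ord_max ^+ 2 + 4 * a ord_max != 0 ->
  jacobiator ob 'X_i 'X_j 'X_k = 0.
Proof.
move=> ab.
have J3 : jacobiator ob 'X_i 'X_j 'X_k \is 3.-homog.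
  by rewrite !rpredD ?od_bracket_homog3 // od_bracket_homog.
apply: (points_dird_eq0 (c := c) (S := [::]) ab J3) => r onr _.
apply: (points_dird_eq0 (c := c) (S := [:: r.1]) ab (dird_homog _ J3)) => q onq.
rewrite inE => qr.
apply: (points_dird_eq0 (c := c) (S := [:: q.1; r.1]) ab (dird_homog _ (dird_homog _ J3))) => p onp.
rewrite !inE negb_or => /andP[pq pr].
exact: jacobi_points.
Qed.
End Jacobi.

(** For generic weights, division by s Lab0 reduces to the weights 1, a, b, c. *)
Lemma od_bracket_poisson (C : numClosedFieldType) (m : nat) (s : od_label -> C) :
  is_poisson (@od_bracket C m s).
Proof.
apply: od_bracket_dense => {}s /andP[s0 ab].
apply: poisson_generators => [|||i j k].
- exact: od_bracket_linear.
- exact: od_bracket_anti.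
- exact: od_bracketM.
pose a r := s (Lab1 r) / s Lab0; pose b r := s (Lab2 r) / s Lab0.
pose c := s Lab3 / s Lab0.
have sE : s = fun K => s Lab0 * od_weight 1 a b c K.
  by apply/funext => -[|r|r|] /=; rewrite ?mulr1 // mulrCA mulfV ?mulr1.
have E p q : od_bracket s p q = s Lab0 *: @od_bracket C m (od_weight 1 a b c) p q.
  by rewrite {1}sE od_bracketZ.
rewrite /jacobiator !E !od_bracketZr -!scalerDr.
rewrite -/(jacobiator _ _ _ _) od_bracket_jacobi ?scaler0 //.
have -> : b ord_max ^+ 2 + 4 * a ord_max =
   (s (Lab2 ord_max) ^+ 2 + 4 * s (Lab1 ord_max) * s Lab0) / s Lab0 ^+ 2.
  by rewrite /a /b; field.
by rewrite mulf_neq0 // invr_eq0 expf_neq0.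
Qed.

(** * A quadratic form is determined by its symmetric tensor *)
Section Functional.
Variables (C : numClosedFieldType) (a : 'I_4 -> C) (b : 'I_3 -> C) (c : C).
Variables (t : C) (d : bool).
Hypothesis tc : t + c != 0.
Local Notation X := ('X_0 : {mpoly C[2]}).
Local Notation Y := ('X_1 : {mpoly C[2]}).
Local Notation P := (Pod a).
Local Notation Q := (Qod b).

(** The values on g^j of a linear functional with f acting as the number t: the
    relation determines them by recursion from those on 1 and g.  The second
    component is the value on g^(j+1). *)
Fixpoint g_values (j : nat) : C * C :=
  if j is j'.+1 then
    let: (x, y) := g_values j' in (y, (P.[t] * x + Q.[t] * y) / (t + c))
  else ((~~ d)%:R, d%:R).

Let h (M : 'X_{1..2}) : C^o := t ^+ M 0 * (g_values (M 1)).1.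
Let L : {mpoly C[2]} -> C^o := mlin h.

Let LE k p q : L (k *: p + q) = k * L p + L q.
Proof. exact: mlin_linear. Qed.

Let ext (l : {mpoly C[2]} -> C^o) :
  linear l -> (forall M, l 'X_[M] = 0) -> forall p, l p = 0.
Proof.
move=> ll lX p.
pose LL := HB.pack_for {linear {mpoly C[2]} -> C^o} l (GRing.isLinear.Build _ _ _ _ _ ll).
rewrite -[l p]/(LL p) [p]mpolyE linear_sum big1 // => M _.
by rewrite linearZ /= lX scaler0.
Qed.

Let LX p : L (X * p) = t * L p.
Proof.
apply/eqP; rewrite -subr_eq0; apply/eqP.
apply: (ext (l := fun p => L (X * p) - t * L p)) => {p} [k p q|M].
  by rewrite mulrDr -scalerAr !LE /GRing.scale /=; ring.
rewrite -mpolyXD /L !mlinX /h !mnmDE !mnm1E /= add0n add1n exprS; ring.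
Qed.

Let LY p : (t + c) * L (Y * (Y * p)) = P.[t] * L p + Q.[t] * L (Y * p).
Proof.
apply/eqP; rewrite -subr_eq0; apply/eqP.
apply: (ext (l := fun p => (t + c) * L (Y * (Y * p)) - (P.[t] * L p + Q.[t] * L (Y * p))))
  => {p} [k p q|M].
  by rewrite !(mulrDr, =^~ scalerAr) !LE /GRing.scale /=; ring.
rewrite -mpolyXD -mpolyXD /L !mlinX /h !mnmDE !mnm1E /= !add0n.
case: (g_values (M 1)) => x y /=.
by field.
Qed.

Let LH (r : {poly C}) p : L (horner_alg X r * p) = r.[t] * L p.
Proof.
elim/poly_ind: r p => [|r k ih] p.
  have L0 : L 0 = 0 by exact: linear0.
  by rewrite raddf0 mul0r L0 horner0 mul0r.
rewrite rmorphD rmorphM /= horner_algX horner_algC mulrDl -mulrA mulr_algl addrC.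
by rewrite LE ih LX hornerMXaddC; ring.
Qed.

Let Lrel p : L (p * rel_od a b c) = 0.
Proof.
have LD q r : L (q + r) = L q + L r by exact: linearD.
have LN q : L (- q) = - L q by exact: linearN.
have LZ k q : L (k%:MP * q) = k * L q by rewrite mul_mpolyC; exact: linearZ.
have -> : p * rel_od a b c = X * (Y * (Y * p)) + c%:MP * (Y * (Y * p))
    - (horner_alg X P * p + horner_alg X Q * (Y * p)).
  by rewrite /rel_od; ring.
by rewrite !(LD, LN, LX, LZ, LH) -mulrDl LY subrr.
Qed.

(** For almost every t, the functional on F that maps sum_i u_i f^i + sum_i v_i f^i g to
    sum_i u_i t^i, respectively to sum_i v_i t^i. *)
Lemma od_functional : exists e : Fod a b c -> C^o, linear e /\
  forall x, e (mon_val (f_od a b c) (g_od a b c) x) = (x.1 == d)%:R * t ^+ x.2.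
Proof.
pose e (x : Fod a b c) := L (repr x).
have eE p : e (pi_od a b c p) = L p.
  have LB q r : L (q - r) = L q - L r by exact: linearB.
  apply/eqP; rewrite /e -subr_eq0 -LB.
  have : repr (pi_od a b c p) - p \in ideal_od a b c.
    by rewrite -pi_od_eq0 rmorphB /= repr_odK subrr.
  by move=> /gen_idealP[r ->]; rewrite big_ord1 /= Lrel.
exists e; split=> [k x y|[d' i]].
  by rewrite -[x]repr_odK -[y]repr_odK -linearP !eE LE.
pose i0 : 'I_2 := 0; pose i1 : 'I_2 := 1.
have -> : mon_val (f_od a b c) (g_od a b c) (d', i) =
    pi_od a b c 'X_[(U_(i0) *+ i + U_(i1) *+ d')%MM].
  by rewrite mpolyXD -!mpolyXn rmorphM !rmorphXn.
rewrite eE /L mlinX /h !mnmDE !mulmnE !mnm1E /= mul1n mul0n addn0 add0n mul1n.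
by case: d' => /=; rewrite mulrC; congr (_%:R * _); case: (d).
Qed.
End Functional.

Section Uniqueness.
Variables (C : numClosedFieldType) (m : nat).
Local Notation n := m.*2.+1.

Lemma homog2_ext (V : lmodType C) (k : nat) (l : {mpoly C[k]} -> V) :
  linear l -> (forall i j, l ('X_i * 'X_j) = 0) ->
  forall p, p \is 2.-homog -> l p = 0.
Proof.
move=> ll lX p hp.
pose LL := HB.pack_for {linear {mpoly C[k]} -> V} l (GRing.isLinear.Build _ _ _ _ _ ll).
rewrite -[l p]/(LL p) [p]mpolyE linear_sum big_seq big1 // => M Mp.
have {hp Mp} dM : mdeg M = 2%N by move/dhomogP: hp => /(_ M Mp).
have [i Mi] : exists i, M i != 0%N by apply: mdeg_neq0; rewrite dM.
have le_iM : (U_(i) <= M)%MM.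
  by apply/mnm_lepP => j; rewrite mnm1E; case: eqP => // <-; rewrite lt0n.
have /mdeg1P[j /eqP jM] : mdeg (M - U_(i)) == 1%N.
  by move: dM; rewrite -{1}(submK le_iM) mdegD mdeg1 addn1 => -[->].
by rewrite linearZ /= -(submK le_iM) jM mpolyXD lX scaler0.
Qed.

Variables (a : 'I_4 -> C) (b : 'I_3 -> C) (c : C).

Lemma gen_od_mon (k : 'I_n) :
  gen_od a b c k = mon_val (f_od a b c) (g_od a b c) (gen_mon k).
Proof.
rewrite /gen_od /x_od /mon_val /gen_mon; case: eqP => [|k0] /=.
  by rewrite mulr1.
case: (odd k) (odd_double_half k) => /= kE; rewrite ?mulr1 ?expr1 //.
by congr (_ ^+ _ * _); rewrite -kE; lia.
Qed.

Lemma functional_dird_eq0 e (q : {mpoly C[n]}) : q \is e.+1.-homog ->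
  (forall t d, t + c != 0 ->
     dird (fun k : 'I_n => ((gen_mon k).1 == d)%:R * t ^+ (gen_mon k).2) q = 0) ->
  q = 0.
Proof.
move=> hq H; apply: (homog_mderiv_eq0 hq) => i; apply/mpolyP => M.
have r0 : 'X + c%:P != 0 :> {poly C} by rewrite -size_poly_eq0 size_XaddC.
rewrite mcoeff0; apply: (gen_mon_coef_eq0 (l := fun i => q^`M(i)@_M) r0) => t.
rewrite hornerD hornerX hornerC => tc d.
have := congr1 (mcoeff M) (H t d tc); rewrite mcoeff0 raddf_sum => E.
rewrite -[RHS]E; apply: eq_bigr => k _ /=.
by rewrite mcoeffZ -mulr_natr; ring.
Qed.

(** A pair of such functionals gives a linear form on F (x) F, whose value at the
    tensor of q is a second directional derivative of q. *)
Lemma sym2_od_inj (q : {mpoly C[n]}) : q \is 2.-homog -> sym2_od a b c q = 0 -> q = 0.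
Proof.
move=> hq q0; apply: (functional_dird_eq0 hq) => t d tc.
apply: (functional_dird_eq0 (dird_homog _ hq)) => t' d' tc'.
have [e [el eE]] := @od_functional C a b c t d tc.
have [e' [el' eE']] := @od_functional C a b c t' d' tc'.
pose B x y : C^o := e x * e' y.
have [|| L [Ll LB _]] := @tens_od_universal C a b c C^o B.
- by move=> y k u v; rewrite /B el /GRing.scale /=; ring.
- by move=> x k u v; rewrite /B el' /GRing.scale /=; ring.
pose x (k : 'I_n) : C := ((gen_mon k).1 == d)%:R * t ^+ (gen_mon k).2.
pose y (k : 'I_n) : C := ((gen_mon k).1 == d')%:R * t' ^+ (gen_mon k).2.
rewrite -/x -/y.
have E i j : L (sym2_od a b c ('X_i * 'X_j)) = x i * y j + x j * y i.
  have LD u v : L (u + v) = L u + L v by have := Ll 1 u v; rewrite !scale1r.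
  by rewrite sym2_odXX LD !LB /B !gen_od_mon !eE !eE'.
pose l p : {mpoly C[n]} := dird y (dird x p) - (L (sym2_od a b c p) : C)%:MP.
have ll : linear l.
  move=> k u v; rewrite /l sym2_od_linear (dirdD x) (dirdZ x) (dirdD y) (dirdZ y).
  rewrite Ll -[k *: L _]/(k * L _ : C) mpolyCD mpolyCM.
  by rewrite -!mul_mpolyC; ring.
have l0 : l q = 0.
  apply: (homog2_ext ll) hq => i j.
  rewrite /l E !(dirdM, dirdX, dirdD, dirdC) mul0r add0r mulr0 addr0.
  by rewrite mpolyCD !mpolyCM; ring.
have L0 : L 0 = 0 by have := Ll (-1) 0 0; rewrite !scaleN1r !addNr.
by move: l0; rewrite /l q0 L0 subr0.
Qed.
End Uniqueness.

(** * The induced bracket *)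
Lemma clear_denominator (A T : comPzRingType) (e : {rmorphism A -> T}) (l : T)
    (tau mu zeta omega nu : A) (k : nat) : e tau * l = e mu ->
  e tau * ((k%:R * l + e zeta) * e omega + e nu) =
  e ((k%:R * mu + tau * zeta) * omega + tau * nu).
Proof.
move=> E; rewrite !(rmorphD, rmorphM) rmorph_nat -E; ring.
Qed.

Section PairNum.
Variables (C : numClosedFieldType) (A : comAlgType C).
Implicit Types k t x y : A.

(** The bracket multiplied by 2 t, where t stands for f_1 - f_2 and k for 2 t K.  The
    arguments are independent elements of a commutative ring, which makes the
    lemmas on pair_num plain polynomial identities. *)
Definition pair_num k t x1 x2 dx1 dx2 y1 y2 dy1 dy2 : A :=
  k * (x1 * y2 - y1 * x2) + 2 * t * (x1 * dy2 + x2 * dy1 - y1 * dx2 - y2 * dx1).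

Lemma pair_num_anti k t x1 x2 dx1 dx2 y1 y2 dy1 dy2 :
  pair_num k t x1 x2 dx1 dx2 y1 y2 dy1 dy2 =
  - pair_num k t y1 y2 dy1 dy2 x1 x2 dx1 dx2.
Proof. by rewrite /pair_num; ring. Qed.

Lemma pair_num_comb (l : C) k t u1 u2 du1 du2 v1 v2 dv1 dv2 y1 y2 dy1 dy2 :
  pair_num k t (l *: u1 + v1) (l *: u2 + v2) (l *: du1 + dv1) (l *: du2 + dv2)
    y1 y2 dy1 dy2 =
  l *: pair_num k t u1 u2 du1 du2 y1 y2 dy1 dy2
  + pair_num k t v1 v2 dv1 dv2 y1 y2 dy1 dy2.
Proof. by rewrite /pair_num !scale_in_alg; ring. Qed.

Lemma mul_sub_comb (l : C) (w p q r s : A) :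
  w * (l *: p + q) - (l *: r + s) = l *: (w * p - r) + (w * q - s).
Proof. by rewrite !scale_in_alg; ring. Qed.

Lemma mul_sub_opp (w p q : A) : w * - p - - q = - (w * p - q).
Proof. by ring. Qed.

Lemma lreg_double (t : A) : GRing.lreg t -> GRing.lreg (2 * t).
Proof.
move=> rt; apply: lregM => // x y E.
have h (z : A) : z = (2%:R^-1 : C) *: (2 * z).
  by rewrite mulr_natl -scaler_nat scalerA mulVf ?pnatr_eq0 // scale1r.
by rewrite (h x) E -h.
Qed.

Lemma half_num (p q r : A) :
  2 * (p - (2%:R^-1 : C) *: q - (2%:R^-1 : C) *: r) = 2 * p - q - r.
Proof.
have h x : 2 * ((2%:R^-1 : C) *: x) = x.
  by rewrite -scalerAr mulr_natl -scaler_nat scalerA mulVf ?pnatr_eq0 // scale1r.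
by rewrite !mulrBr !h.
Qed.

Lemma half_cross (k : C) (t w : A) :
  2 * t * (w + (2%:R^-1 * k) *: t) = t * (2 * w + k%:A * t).
Proof.
have -> : k%:A = 2 * (2%:R^-1 * k)%:A :> A.
  by rewrite mulr_natl -scaler_nat scalerA mulrA mulfV ?pnatr_eq0 // mul1r.
by rewrite !scale_in_alg; ring.
Qed.
End PairNum.

Section Induced.
Variables (C : numClosedFieldType) (m : nat).
Variables (a : 'I_4 -> C) (b : 'I_3 -> C) (c : C).
Local Notation n := m.*2.+1.
Local Notation F := (Fod a b c).
Local Notation FF := (FFod a b c).
Local Notation f := (f_od a b c).
Local Notation g := (g_od a b c).
Local Notation i1 := (@in1 C a b c).
Local Notation i2 := (@in2 C a b c).
Local Notation D := (@D_od C a b c).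
Local Notation ob := (@od_bracket C m (od_weight 1 a b c)).

Lemma on_curve_morph (A B : comAlgType C) (e : {lrmorphism A -> B}) (x y : A) :
  on_curve a b c x y -> on_curve a b c (e x) (e y).
Proof.
rewrite /on_curve => /(congr1 e); rewrite !(rmorphM, rmorphD, rmorphXn) /=.
by rewrite !lrmorph_horner_alg rmorph_alg.
Qed.

Lemma curve_der_morph (A B : comAlgType C) (e : {lrmorphism A -> B}) (x y : A) s :
  e (curve_der a b c x y s) = curve_der a b c (e x) (e y) s.
Proof.
rewrite /curve_der /mon_der /curve_df /curve_dg.
rewrite !(rmorph_nat, rmorphD, rmorphN, rmorphM, rmorphXn) /= !lrmorph_horner_alg.
by rewrite rmorph_alg.
Qed.

Let on1 : on_curve a b c (i1 f) (i1 g) := on_curve_morph i1 (od_relation a b c).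
Let on2 : on_curve a b c (i2 f) (i2 g) := on_curve_morph i2 (od_relation a b c).

Definition tensor_num (x y : F) : FF :=
  pair_num (kernel_num b c n%:R (i1 f) (i1 g) (i2 f) (i2 g)) (i1 f - i2 f)
    (i1 x) (i2 x) (i1 (D x)) (i2 (D x)) (i1 y) (i2 y) (i1 (D y)) (i2 (D y)).

Let tensor_num_anti x y : tensor_num x y = - tensor_num y x.
Proof. exact: pair_num_anti. Qed.

Let tensor_num_linear y : linear (tensor_num^~ y).
Proof.
move=> k u v; rewrite /tensor_num (D_od_linear k u v).
rewrite (in1_linear k u v) (in2_linear k u v).
rewrite (in1_linear k (D u) (D v)) (in2_linear k (D u) (D v)).
exact: pair_num_comb.
Qed.

Let morph_mon (e : {lrmorphism F -> FF}) x : e (mon_val f g x) = mon_val (e f) (e g) x.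
Proof. by rewrite /mon_val rmorphM !rmorphXn. Qed.

Let morph_der (e : {lrmorphism F -> FF}) x :
  e (D (mon_val f g x)) = curve_der a b c (e f) (e g) x.
Proof. by rewrite D_od_mon curve_der_morph. Qed.

Let mon1 x : i1 (mon_val f g x) = mon_val (i1 f) (i1 g) x := morph_mon i1 x.
Let mon2 x : i2 (mon_val f g x) = mon_val (i2 f) (i2 g) x := morph_mon i2 x.
Let der1 x : i1 (D (mon_val f g x)) = curve_der a b c (i1 f) (i1 g) x :=
  morph_der i1 x.
Let der2 x : i2 (D (mon_val f g x)) = curve_der a b c (i2 f) (i2 g) x :=
  morph_der i2 x.

Lemma sym2_od_generators (k l : 'I_n) :
  2 * (i1 f - i2 f) * sym2_od a b c (ob 'X_k 'X_l) =
  tensor_num (gen_od a b c k) (gen_od a b c l).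
Proof.
have -> : sym2_od a b c (ob 'X_k 'X_l) = weighted n%:R
    (sym_val (i1 f) (i1 g) (i2 f) (i2 g)) (od_weight 1 a b c) (gen_mon k) (gen_mon l).
  rewrite od_bracketX (weighted_linear _ (@sym2_od C a b c n)).
  apply: eq_weighted_in; rewrite ?gen_mon_range // => p q.
  - by rewrite /mon_mul mulrC.
  - exact: sym_valC.
  move=> hp hq; rewrite /= sym2_odXX !gen_od_mon !mon_ordK // /tens.
  by rewrite !mon1 !mon2.
rewrite (weighted_bracket_num n%:R on1 on2) /tensor_num !gen_od_mon.
by rewrite !mon1 !mon2 !der1 !der2.
Qed.

Lemma homog1_ext (V : lmodType C) (k : nat) (l : {mpoly C[k]} -> V) :
  linear l -> (forall i, l 'X_i = 0) -> forall p, p \is 1.-homog -> l p = 0.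
Proof.
move=> ll lX p hp.
pose LL := HB.pack_for {linear {mpoly C[k]} -> V} l (GRing.isLinear.Build _ _ _ _ _ ll).
rewrite -[l p]/(LL p) (dhomog1E hp) linear_sum big1 // => i _.
by rewrite linearZ /= lX scaler0.
Qed.

Lemma sym2_od_bracket (p q : {mpoly C[n]}) : p \is 1.-homog -> q \is 1.-homog ->
  2 * (i1 f - i2 f) * sym2_od a b c (ob p q) =
  tensor_num (lin_od a b c p) (lin_od a b c q).
Proof.
pose l q p := 2 * (i1 f - i2 f) * sym2_od a b c (ob p q)
  - tensor_num (lin_od a b c p) (lin_od a b c q).
have ll r : linear (l r).
  move=> k u v; rewrite /l od_bracket_linear sym2_od_linear lin_od_linear.
  rewrite tensor_num_linear; exact: mul_sub_comb.
have lA r s : l r s = - l s r.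
  rewrite /l od_bracket_anti (linearN (@sym2_od C a b c n)) tensor_num_anti.
  exact: mul_sub_opp.
have lX i j : l 'X_i 'X_j = 0.
  by rewrite /l sym2_od_generators !lin_odX subrr.
move=> hp hq; apply/eqP; rewrite -subr_eq0; apply/eqP; rewrite -/(l q p).
apply: (homog1_ext (ll q)) hp => i; rewrite lA.
by rewrite (homog1_ext (ll _) _ hq) ?oppr0.
Qed.

Hypothesis reg : GRing.lreg (i1 f - i2 f).

Lemma lambda_tensor_num x y :
  (2 * (i1 f - i2 f))%:F * bracket_od n x y = (tensor_num x y)%:F.
Proof.
have E : (2 * (i1 f - i2 f))%:F * lambda_od a b c = (2 * lambda_od_num a b c)%:F.
  by rewrite rmorphM -mulrA lambda_odP // -rmorphM.
rewrite /bracket_od (clear_denominator _ _ _ _ E); congr (_%:F).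
rewrite /lambda_od_num half_num half_cross /tensor_num /pair_num /kernel_num.
by rewrite (rmorph_nat (in_alg FF)).
Qed.

Lemma od_bracket_induced : induced_od a b c ob.
Proof.
move=> p q hp hq; split.
  apply: rpred_sum => k _; apply: rpred_sum => l _.
  have := od_bracket_homog (od_weight 1 a b c) k l; rewrite od_bracketX => T2.
  exact: (dhomogM (dhomogM (mderiv_homog k hp) (mderiv_homog l hq)) T2).
have reg2 := lreg_double reg.
apply: (TotalFrac.tofrac_lreg reg2).
by rewrite /= lambda_tensor_num -rmorphM sym2_od_bracket.
Qed.

Lemma od_bracket_unique (br : bracket C n) : is_poisson br -> induced_od a b c br ->
  forall p q, br p q = ob p q.
Proof.
move=> brP brI; apply: (poisson_unique brP (od_bracket_poisson _ _)) => i j.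
have hX (k : 'I_n) : ('X_k : {mpoly C[n]}) \is 1.-homog by rewrite dhomogX /= mdeg1.
have [h1 e1] := brI _ _ (hX i) (hX j).
have [h2 e2] := od_bracket_induced (hX i) (hX j).
apply/eqP; rewrite -subr_eq0; apply/eqP; apply: (@sym2_od_inj C m a b c).
  by rewrite rpredB.
rewrite linearB /=; apply/eqP; rewrite subr_eq0; apply/eqP.
by apply: TotalFrac.tofrac_inj; rewrite e1 e2.
Qed.
End Induced.

Section Labels.
Variables (C : numClosedFieldType) (m : nat).

(** The weights that single out one of the nine brackets. *)
Definition label_ind (K L : od_label) : C :=
  match K, L with
  | Lab0, Lab0 | Lab3, Lab3 => 1
  | Lab1 r, Lab1 r' => (r' == r)%:R
  | Lab2 r, Lab2 r' => (r' == r)%:R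
  | _, _ => 0
  end.

Lemma label_bracketE K p q :
  @label_bracket C m K p q = od_bracket (label_ind K) p q.
Proof.
have sum0 (k : nat) (F : 'I_k -> {mpoly C[m.*2.+1]}) : \sum_(r < k) (0 : C) *: F r = 0.
  by rewrite big1 // => r _; rewrite scale0r.
have sum1 (k : nat) (F : 'I_k -> {mpoly C[m.*2.+1]}) (r : 'I_k) :
    \sum_(r' < k) (r' == r)%:R *: F r' = F r.
  rewrite (bigD1 r) //= eqxx scale1r big1 ?addr0 // => r' /negPf ->.
  by rewrite scale0r.
by rewrite od_bracketE; case: K => [|r|r|] /=;
  rewrite ?sum0 ?sum1 ?scale0r ?scale1r ?addr0 ?add0r.
Qed.
End Labels.

Theorem mainTheorem2 (R : realType) (n : nat) (n_odd : odd n) :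
  exists B : od_label -> bracket R[i] n,
    [/\ forall k, is_poisson (B k) /\ is_quadratic (B k),
        forall k l, k <> l -> compatible (B k) (B l) &
        forall (a : 'I_4 -> R[i]) (b : 'I_3 -> R[i]) (c : R[i]),
          GRing.lreg (in1 (f_od a b c) - in2 (f_od a b c)) ->
          let br : bracket R[i] n := fun p q =>
            B Lab0 p q + \sum_(i < 4) a i *: B (Lab1 i) p q
            + \sum_(j < 3) b j *: B (Lab2 j) p q + c *: B Lab3 p q in
          [/\ is_poisson br,
              is_quadratic br,
              induced_od a b c br &
              forall br' : bracket R[i] n,
                is_poisson br' -> induced_od a b c br' ->
                forall p q, br' p q = br p q]].
Proof.
have {n_odd} [m ->] : exists m, n = m.*2.+1.
  by exists n./2; rewrite -[LHS]odd_double_half n_odd.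
exists (@label_bracket R[i] m); split.
- move=> k; have -> : @label_bracket R[i] m k = od_bracket (label_ind _ k).
    by apply/funext => p; apply/funext => q; exact: label_bracketE.
  by split; [exact: od_bracket_poisson|exact: od_bracket_homog].
- move=> k l _ u.
  have -> : (fun p q => @label_bracket R[i] m k p q + u *: @label_bracket R[i] m l p q) =
      od_bracket (fun K => label_ind _ k K + u * label_ind _ l K).
    by apply/funext => p; apply/funext => q; rewrite !label_bracketE -od_bracket_comb.
  exact: od_bracket_poisson.
move=> a b c reg br.
have -> : br = od_bracket (od_weight 1 a b c).
  by apply/funext => p; apply/funext => q; rewrite od_bracketE scale1r.
split.
- exact: od_bracket_poisson.
- exact: od_bracket_homog.
- exact: od_bracket_induced.
- by move=> br' brP brI; apply: od_bracket_unique.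
Qed.
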